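(* Let $\mathfrak g$ be the $5$-dimensional real Lie algebra with basis $e_1,\dots,e_5$ and dual basis $e^1,\dots,e^5$ of $\mathfrak g^*$ determined by $$de^1=\tfrac{\sqrt3}{2}e^{25}+\tfrac12 e^{14},\quad de^2=\tfrac{\sqrt3}{2}e^{15}+\tfrac12 e^{24},\quad de^3=e^{12}+e^{34},\quad de^4=de^5=0,$$ and let $G$ be the connected, simply connected Lie group with Lie algebra $\mathfrak g$. Then the solvable Lie group $G$ has an Einstein almost cokähler structure which is not cokähler and satisfies $$\frac{\tau-\tau^*}{\tau}=\frac14,$$ where $\mathrm{Ric}=\tau g$.
   Context: Here $e^{ij}=e^i\wedge e^j$ and $d$ is the Chevalley–Eilenberg differential, $de(X,Y)=-e([X,Y])$ for $e\in\mathfrak g^*$. An almost contact metric structure $(\alpha,\omega,g)$ on a $(2n+1)$-dimensional manifold $M$ consists of a $1$-form $\alpha$, a $2$-form $\omega$ and a Riemannian metric $g$ such that near each point there is an orthonormal coframe $f^1,\dots,f^{2n+1}$ with $\alpha=f^{2n+1}$ and $\omega=f^{1}\wedge f^2+f^3\wedge f^4+\dots+f^{2n-1}\wedge f^{2n}$. It is almost cokähler if $d\alpha=0$ and $d\omega=0$, and cokähler if $\alpha$ and $\omega$ are both parallel for the Levi-Civita connection $\nabla$ of $g$. It is Einstein if $\mathrm{Ric}=\tau g$ with $\tau$ constant. Let $J$ be the endomorphism of $TM$ with $\omega(X,Y)=g(JX,Y)$ (so $J$ kills the Reeb vector field dual to $\alpha$ and is an almost complex structure on $\ker\alpha$). With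 $R(X,Y)Z=\nabla_X\nabla_YZ-\nabla_Y\nabla_XZ-\nabla_{[X,Y]}Z$ and a local orthonormal frame $f_1,\dots,f_{2n+1}$, the $*$-Ricci form is $\rho^*(X,Y)=\sum_i g(R(X,f_i)(Jf_i),Y)$, and $\tau^*=\frac1n\langle\omega,\rho^*\rangle$, where the inner product on $2$-forms is the one for which the $f^i\wedge f^j$, $i<j$, are orthonormal. Here $n=2$. *)

(* Defs.v *)
From HB Require Import structures.
From mathcomp Require Import all_boot all_order all_algebra.
From mathcomp Require Import all_classical all_reals all_analysis.
Set Implicit Arguments.
Unset Strict Implicit.
Unset Printing Implicit Defensive.
Import Order.TTheory GRing.Theory Num.Theory.
Import numFieldNormedType.Exports.
Local Open Scope classical_set_scope.
Local Open Scope ring_scope.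

(* Meant for [A] open and [V] finite-dimensional: being C^k.+1 is then the same
   as being differentiable with all directional derivatives C^k. *)
Fixpoint Ck (R : realType) (V W : normedModType R) (k : nat) (A : set V)
    (f : V -> W) : Prop :=
  if k is k'.+1 then
    (forall x, A x -> differentiable f x) /\
    (forall v, Ck k' A (fun x => 'D_v f x))
  else forall x, A x -> {for x, continuous f}.

Definition smooth_on (R : realType) (V W : normedModType R) (A : set V)
    (f : V -> W) : Prop := forall k, Ck k A f.

(* [phi] and [psi] are total functions; only their restrictions to [dom] and
   to [phi @` dom], which are inverse homeomorphisms, are meaningful. *)
Record chart (R : realType) (d : nat) (T : topologicalType) := Chart {
  dom : set T;
  phi : T -> 'rV[R]_d;
  psi : 'rV[R]_d -> T;
  open_dom : open dom;
  open_phi_dom : open (phi @` dom);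
  phiK : forall p, dom p -> psi (phi p) = p;
  phi_continuous : forall p, dom p -> {for p, continuous phi};
  psi_continuous : forall x, (phi @` dom) x -> {for x, continuous psi} }.

(* The atlas is the family of the [chart_at p]: each point has a preferred chart
   around it, which identifies the tangent space at [p] with ['rV[R]_d]. *)
Record manifold (R : realType) (d : nat) := Manifold {
  carrier :> topologicalType;
  manifold_hausdorff : hausdorff_space carrier;
  manifold_second_countable : @second_countable carrier;
  chart_at : carrier -> chart R d carrier;
  dom_chart_at : forall p, dom (chart_at p) p;
  smooth_transition : forall p q,
    smooth_on (phi (chart_at p) @` (dom (chart_at p) `&` dom (chart_at q)))
              (phi (chart_at q) \o psi (chart_at p)) }.

(* Tensor fields are functions on the manifold, the value at [p] being expressed
   in the preferred chart at [p]: a vector is a row, a covector [a] is a column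
   with [a(v) = v *m a], and a bilinear form [B] is a matrix with
   [B(v, w) = v *m B *m w^T]. *)
Definition vector_field (R : realType) d (M : manifold R d) : Type :=
  M -> 'rV[R]_d.
Definition covector_field (R : realType) d (M : manifold R d) : Type :=
  M -> 'cV[R]_d.
Definition bilinear_field (R : realType) d (M : manifold R d) : Type :=
  M -> 'M[R]_d.

Section Fields.
Context {R : realType} {d : nat} {M : manifold R d}.
Implicit Types (U : set M) (X Y Z : vector_field M) (F : M -> R) (p : M).
Implicit Types (a : covector_field M) (B : bilinear_field M).

Definition chart_image p U : set 'rV[R]_d :=
  phi (chart_at p) @` (dom (chart_at p) `&` U).

Definition smooth_fun U F : Prop :=
  forall p, smooth_on (chart_image p U) (F \o psi (chart_at p)).

(* the components of [X] in the chart [chart_at p], as a function of the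
   coordinates in this chart *)
Definition in_chart p X : 'rV[R]_d -> 'rV[R]_d := fun x =>
  let q := psi (chart_at p) x in
  'D_(X q) (phi (chart_at p) \o psi (chart_at q)) (phi (chart_at q) q).

Definition smooth_field U X : Prop :=
  forall p, smooth_on (chart_image p U) (in_chart p X).

Definition lie_deriv X F : M -> R := fun p =>
  'D_(X p) (F \o psi (chart_at p)) (phi (chart_at p) p).

(* [X^i d_i Y^k - Y^i d_i X^k] *)
Definition lie_bracket X Y : vector_field M := fun p =>
  'D_(X p) (in_chart p Y) (phi (chart_at p) p)
  - 'D_(Y p) (in_chart p X) (phi (chart_at p) p).

Definition ev1 a X : M -> R := fun p => (X p *m a p) 0 0.

Definition ev2 B X Y : M -> R := fun p => (X p *m B p *m (Y p)^T) 0 0.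

Definition smooth_covector U a : Prop :=
  forall V X, open V -> V `<=` U -> smooth_field V X -> smooth_fun V (ev1 a X).

Definition smooth_bilinear U B : Prop :=
  forall V X Y, open V -> V `<=` U -> smooth_field V X -> smooth_field V Y ->
    smooth_fun V (ev2 B X Y).

(* Exterior derivatives, with the convention
   [da(X, Y) = X a(Y) - Y a(X) - a([X, Y])]. *)
Definition ext_d1 a X Y : M -> R := fun p =>
  lie_deriv X (ev1 a Y) p - lie_deriv Y (ev1 a X) p - ev1 a (lie_bracket X Y) p.

Definition ext_d2 B X Y Z : M -> R := fun p =>
  lie_deriv X (ev2 B Y Z) p - lie_deriv Y (ev2 B X Z) p
  + lie_deriv Z (ev2 B X Y) p
  - ev2 B (lie_bracket X Y) Z p + ev2 B (lie_bracket X Z) Y p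
  - ev2 B (lie_bracket Y Z) X p.

Definition closed1 a : Prop :=
  forall U X Y, open U -> smooth_field U X -> smooth_field U Y ->
    forall p, U p -> ext_d1 a X Y p = 0.

Definition closed2 B : Prop :=
  forall U X Y Z, open U -> smooth_field U X -> smooth_field U Y ->
    smooth_field U Z -> forall p, U p -> ext_d2 B X Y Z p = 0.

Definition riemannian_metric (g : bilinear_field M) : Prop :=
  [/\ smooth_bilinear setT g, forall p, (g p)^T = g p &
      forall p (v : 'rV[R]_d), v != 0 -> 0 < (v *m g p *m v^T) 0 0].

(* A connection takes total functions as arguments, but it is only specified on
   an open set on which they are smooth, and only through their restrictions to
   this set. *)
Definition connection : Type :=
  vector_field M -> vector_field M -> vector_field M.

Record is_levi_civita (g : bilinear_field M) (nabla : connection) : Prop :=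
  IsLeviCivita {
  nabla_smooth : forall U X Y, open U -> smooth_field U X -> smooth_field U Y ->
    smooth_field U (nabla X Y);
  nabla_addl : forall U X X' Y p, open U -> smooth_field U X ->
    smooth_field U X' -> smooth_field U Y -> U p ->
    nabla (X + X') Y p = nabla X Y p + nabla X' Y p;
  nabla_scalel : forall U F X Y p, open U -> smooth_fun U F ->
    smooth_field U X -> smooth_field U Y -> U p ->
    nabla (fun q => F q *: X q) Y p = F p *: nabla X Y p;
  nabla_addr : forall U X Y Y' p, open U -> smooth_field U X ->
    smooth_field U Y -> smooth_field U Y' -> U p ->
    nabla X (Y + Y') p = nabla X Y p + nabla X Y' p;
  nabla_leibniz : forall U F X Y p, open U -> smooth_fun U F ->
    smooth_field U X -> smooth_field U Y -> U p ->
    nabla X (fun q => F q *: Y q) p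
      = lie_deriv X F p *: Y p + F p *: nabla X Y p;
  nabla_torsion_free : forall U X Y p, open U -> smooth_field U X ->
    smooth_field U Y -> U p ->
    nabla X Y p - nabla Y X p = lie_bracket X Y p;
  nabla_metric : forall U X Y Z p, open U -> smooth_field U X ->
    smooth_field U Y -> smooth_field U Z -> U p ->
    lie_deriv X (ev2 g Y Z) p = ev2 g (nabla X Y) Z p + ev2 g Y (nabla X Z) p }.

Definition parallel1 (nabla : connection) a : Prop :=
  forall U X Y, open U -> smooth_field U X -> smooth_field U Y ->
    forall p, U p -> lie_deriv X (ev1 a Y) p - ev1 a (nabla X Y) p = 0.

Definition parallel2 (nabla : connection) B : Prop :=
  forall U X Y Z, open U -> smooth_field U X -> smooth_field U Y ->
    smooth_field U Z -> forall p, U p ->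
    lie_deriv X (ev2 B Y Z) p - ev2 B (nabla X Y) Z p - ev2 B Y (nabla X Z) p
      = 0.

Definition curvature (nabla : connection) X Y Z : vector_field M :=
  nabla X (nabla Y Z) - nabla Y (nabla X Z) - nabla (lie_bracket X Y) Z.

Definition orthonormal_frame (g : bilinear_field M) U
    (f : 'I_d -> vector_field M) : Prop :=
  (forall i, smooth_field U (f i)) /\
  (forall p i j, U p -> ev2 g (f i) (f j) p = (i == j)%:R).

(* the trace of [X |-> R(X, Y)Z], computed in an orthonormal frame [f] *)
Definition ricci (g : bilinear_field M) (nabla : connection)
    (f : 'I_d -> vector_field M) Y Z : M -> R := fun p =>
  \sum_(i < d) ev2 g (curvature nabla (f i) Y Z) (f i) p.

Definition einstein (g : bilinear_field M) (nabla : connection) (tau : R) :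
    Prop :=
  forall U (f : 'I_d -> vector_field M) Y Z, open U ->
    orthonormal_frame g U f -> smooth_field U Y -> smooth_field U Z ->
    forall p, U p -> ricci g nabla f Y Z p = tau * ev2 g Y Z p.

(* The endomorphism [J] with [w(X, Y) = g(JX, Y)]: see [J_fieldP]. *)
Definition J_field (w g : bilinear_field M) X : vector_field M := fun p =>
  X p *m (w p *m invmx (g p)).

Lemma J_fieldP (w g : bilinear_field M) X Y p : g p \in unitmx ->
  ev2 g (J_field w g X) Y p = ev2 w X Y p.
Proof. by move=> gu; rewrite /ev2 /J_field -!mulmxA mulKmx. Qed.

Definition star_ricci (w g : bilinear_field M) (nabla : connection)
    (f : 'I_d -> vector_field M) X Y : M -> R := fun p =>
  \sum_(i < d) ev2 g (curvature nabla X (f i) (J_field w g (f i))) Y p.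

(* Inner product of 2-forms for which the [f^i /\ f^j], [i < j], are
   orthonormal; a 2-form is given by its values on vector fields. *)
Definition inner2 (f : 'I_d -> vector_field M)
    (b c : vector_field M -> vector_field M -> M -> R) : M -> R := fun p =>
  \sum_(i < d) \sum_(j < d | (i < j)%N) b (f i) (f j) p * c (f i) (f j) p.

End Fields.

Definition wedge (R : realType) d (a b : 'cV[R]_d) : 'M[R]_d :=
  a *m b^T - b *m a^T.

Section AlmostContact.
Context {R : realType} {n : nat} {M : manifold R n.*2.+1}.
Implicit Types (alpha : covector_field M) (omega g : bilinear_field M).

(* [a^T *m invmx g *m b] is the inner product of covectors induced by [g]. *)
Definition orthonormal_coframe g (U : set M)
    (f : 'I_n.*2.+1 -> covector_field M) : Prop :=
  (forall i, smooth_covector U (f i)) /\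
  (forall p i j, U p ->
     ((f i p)^T *m invmx (g p) *m f j p) 0 0 = (i == j)%:R).

Definition almost_contact_metric alpha omega g : Prop :=
  [/\ smooth_covector setT alpha, smooth_bilinear setT omega,
      riemannian_metric g &
      forall p, exists (U : set M) (f : 'I_n.*2.+1 -> covector_field M),
        [/\ open U, U p, orthonormal_coframe g U f,
            forall q, U q -> alpha q = f ord_max q &
            forall q, U q -> omega q =
              \sum_(i < n) wedge (f (inord i.*2) q) (f (inord i.*2.+1) q)]].

Definition almost_cokahler alpha omega g : Prop :=
  [/\ almost_contact_metric alpha omega g, closed1 alpha & closed2 omega].

Definition cokahler alpha omega g (nabla : @connection R _ M) : Prop :=
  [/\ almost_contact_metric alpha omega g, is_levi_civita g nabla,
      parallel1 nabla alpha & parallel2 nabla omega].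

Definition tau_star omega g (nabla : @connection R _ M)
    (f : 'I_n.*2.+1 -> vector_field M) : M -> R := fun p =>
  n%:R^-1 * inner2 f (ev2 omega) (star_ricci omega g nabla f) p.

End AlmostContact.

Definition smooth_map (R : realType) d d' (M : manifold R d)
    (N : manifold R d') (F : M -> N) : Prop :=
  continuous F /\
  forall p q, smooth_on
    (phi (chart_at p) @` (dom (chart_at p) `&` F @^-1` dom (chart_at q)))
    (phi (chart_at q) \o F \o psi (chart_at p)).

Definition smooth_map2 (R : realType) d d' d'' (M : manifold R d)
    (M' : manifold R d') (N : manifold R d'') (F : M -> M' -> N) : Prop :=
  continuous (fun z : M * M' => F z.1 z.2) /\
  forall p q r, smooth_on
    [set z : 'rV[R]_d * 'rV[R]_d' | exists x y,
       [/\ dom (chart_at p) x, dom (chart_at q) y, dom (chart_at r) (F x y)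
         & z = (phi (chart_at p) x, phi (chart_at q) y)]]
    (fun z => phi (chart_at r)
                (F (psi (chart_at p) z.1) (psi (chart_at q) z.2))).

Record lieGroup (R : realType) (d : nat) := LieGroup {
  lie_manifold :> manifold R d;
  lg_mul : lie_manifold -> lie_manifold -> lie_manifold;
  lg_one : lie_manifold;
  lg_inv : lie_manifold -> lie_manifold;
  lg_mulA : associative lg_mul;
  lg_mul1 : left_id lg_one lg_mul;
  lg_mulV : left_inverse lg_one lg_inv lg_mul;
  lg_mul_smooth : smooth_map2 lg_mul;
  lg_inv_smooth : smooth_map lg_inv }.

Definition tangent_map (R : realType) d d' (M : manifold R d)
    (N : manifold R d') (F : M -> N) (p : M) (v : 'rV[R]_d) : 'rV[R]_d' :=
  'D_v (phi (chart_at (F p)) \o F \o psi (chart_at p)) (phi (chart_at p) p).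

Definition left_invariant (R : realType) d (G : lieGroup R d)
    (X : vector_field G) : Prop :=
  forall h p, X (lg_mul h p) = tangent_map (lg_mul h) p (X p).

Definition lie_algebra (R : realType) d (G : lieGroup R d) :
    set (vector_field G) :=
  [set X | smooth_field setT X /\ left_invariant X].
Arguments lie_algebra {R d} G.

(* The Lie algebra of [G] is isomorphic to ['rV[R]_m] with bracket [br]. *)
Definition has_lie_algebra (R : realType) d (G : lieGroup R d) m
    (br : 'rV[R]_m -> 'rV[R]_m -> 'rV[R]_m) : Prop :=
  exists L : {linear 'rV[R]_m -> vector_field G},
    [/\ injective L, range L = lie_algebra G &
        forall x y, L (br x y) = lie_bracket (L x) (L y)].

(* the linear span of the brackets of elements of [S] *)
Definition derived_set (R : realType) (V : lmodType R) (br : V -> V -> V)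
    (S : set V) : set V :=
  [set z | forall W : set V, W 0 ->
     (forall (c : R) x y, W x -> W y -> W (c *: x + y)) ->
     (forall x y, S x -> S y -> W (br x y)) -> W z].

Definition solvable_lieGroup (R : realType) d (G : lieGroup R d) : Prop :=
  exists k, iter k (derived_set (@lie_bracket R d G)) (lie_algebra G)
              `<=` [set 0].

Definition simply_connected (R : realType) (T : topologicalType) : Prop :=
  (forall x y : T, exists c : R -> T,
     [/\ {within `[0, 1], continuous c}, c 0 = x & c 1 = y]) /\
  (forall c : R -> T, {within `[0, 1], continuous c} -> c 0 = c 1 ->
     exists H : R * R -> T,
       [/\ {within `[0, 1] `*` `[0, 1], continuous H},
           forall t, t \in `[0, 1] -> H (0, t) = c t,
           forall t, t \in `[0, 1] -> H (1, t) = c 0,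
           forall s, s \in `[0, 1] -> H (s, 0) = c 0 &
           forall s, s \in `[0, 1] -> H (s, 1) = c 0]).

(* The dual basis [e^1, ..., e^5] and [e^{ij}], with indices starting at 1. *)
Definition cov (R : realType) (i : nat) : 'cV[R]_5 := delta_mx (inord i.-1) 0.
Definition cov2 (R : realType) (i j : nat) : 'M[R]_5 :=
  wedge (cov R i) (cov R j).

(* [de R k] is [d e^{k+1}]. *)
Definition de (R : realType) (k : 'I_5) : 'M[R]_5 :=
  match nat_of_ord k with
  | 0 => (Num.sqrt 3 / 2) *: cov2 R 2 5 + 2^-1 *: cov2 R 1 4
  | 1 => (Num.sqrt 3 / 2) *: cov2 R 1 5 + 2^-1 *: cov2 R 2 4
  | 2 => cov2 R 1 2 + cov2 R 3 4
  | _ => 0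
  end.

(* the bracket on ['rV[R]_5] determined by [e([x, y]) = - de(x, y)] *)
Definition g_bracket (R : realType) (x y : 'rV[R]_5) : 'rV[R]_5 :=
  \row_k - (x *m de R k *m y^T) 0 0.

(* Main.v *)
(* In the left-invariant frame e_1, ..., e_5, which is taken to be orthonormal,
   alpha = e^5 and omega = e^12 + e^34 have constant coefficients, and they are
   closed by the structure equations (omega is the differential of e^3).  For a
   frame with constant structure coefficients, the Koszul formula gives constant
   Christoffel symbols; since second directional derivatives commute, a bracket
   of fields acts on functions as a commutator, so the curvature is the constant
   tensor R(x, y) = [Gam x, Gam y] - Gam [x, y].  Its traces are a finite
   computation: tau = - 3/2 and tau^* = - 9/8.  The structure is not cokaehler
   because e^5(nabla_(e_1) e_2) = sqrt 3 / 2. *)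
Require Import Defs.
From HB Require Import structures.
From mathcomp Require Import all_boot all_order all_algebra.
From mathcomp Require Import all_classical all_reals all_analysis.
From mathcomp Require Import ring lra.
Set Implicit Arguments.
Unset Strict Implicit.
Unset Printing Implicit Defensive.
Import Order.TTheory GRing.Theory Num.Theory.
Import numFieldNormedType.Exports.
Local Open Scope classical_set_scope.
Local Open Scope ring_scope.

(** * Smooth maps and symmetry of second derivatives *)

(** The value of a field at a point is written in the preferred chart of that point, and this chart
    may jump from point to point. A smooth field is therefore not a smooth function of the point and
    cannot be differentiated repeatedly as it stands. An invertible frame repairs this: in the row
    [comp X] of components the change of charts cancels, so smoothness, bracket and connection
    become statements about smooth real functions and constant tables. After [comp_bracket] the
    curvature computation never refers to a chart. A basis of the Lie algebra gives such a frame
    because a left-invariant field that vanishes at one point vanishes everywhere. The Einstein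
    condition and [tau_star] are stated for an arbitrary local orthonormal frame, so the traces
    found in the left-invariant frame are carried over by an orthogonal matrix that varies with the
    point. *)

Section Calculus.
Context {R : realType} {V : normedModType R}.

Lemma near_open (A : set V) x (P : V -> Prop) : open A -> A x ->
  (forall y, A y -> P y) -> \forall y \near x, P y.
Proof.
by move=> oA Ax AP; apply: filterS AP _; exact: open_nbhs_nbhs.
Qed.

(** The difference [g - f] vanishes near [x], so the zero map is its differential there. *)
Lemma near_eq_differentiable {W : normedModType R} (f g : V -> W) x :
  {near x, f =1 g} -> differentiable f x -> differentiable g x.
Proof.
move=> fg df; rewrite -[g](subrKC f); apply: differentiableD => //.
have h0 : (g - f) x = 0 by rewrite -[LHS]/(g x - f x) (nbhs_singleton fg) subrr.
have dh : continuous (\0 : {linear V -> W}) /\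
    (g - f) \o shift x = cst ((g - f) x) + (\0 : {linear V -> W}) +o_ 0 id.
  split; first exact: cst_continuous.
  apply/eqaddoP => e e0.
  have := fg; rewrite (near_shift 0) subr0 /=.
  apply: filterS => y /= fgy.
  rewrite [X in `|X|](_ : _ = 0); first by rewrite normr0 mulr_ge0// ltW.
  rewrite h0 -[LHS]/((g (y + x) - f (y + x)) - (0 + 0)).
  by rewrite addr0 subr0 fgy subrr.
by apply/diff_locallyP; rewrite (diff_unique dh.1 dh.2); exact: dh.
Qed.

Lemma derive_scaleE {W : normedModType R} (f : V -> W) x (c : R) v :
  differentiable f x -> 'D_(c *: v) f x = c *: 'D_v f x.
Proof. by move=> df; rewrite !deriveE// linearZ. Qed.

Lemma derive_sumE {W : normedModType R} (f : V -> W) x (I : finType)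
    (v : I -> V) :
  differentiable f x -> 'D_(\sum_i v i) f x = \sum_i 'D_(v i) f x.
Proof.
by move=> df; rewrite deriveE// linear_sum; apply: eq_bigr => i _; rewrite deriveE.
Qed.

Lemma derive_comp {U V' W : normedModType R} (f : U -> V') (g : V' -> W) x v :
  differentiable f x -> differentiable g (f x) ->
  'D_v (g \o f) x = 'D_('D_v f x) g (f x).
Proof.
move=> df dg; rewrite [LHS]deriveE; last exact: differentiable_comp.
by rewrite diff_comp// !deriveE.
Qed.

Lemma is_derive_line (f : V -> R) (y u : V) (s : R) : differentiable f (s *: u + y) ->
  is_derive s 1 (fun s : R => f (s *: u + y)) ('D_u f (s *: u + y)).
Proof.
move=> df; pose c : R -> V := (fun s => s *: u) + cst y.
have dc : is_diff s c ((fun s => s *: u) + 0) by rewrite /c; apply: is_diffD.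
have dfc : differentiable (f \o c) s by apply: differentiable_comp.
split; first by apply: diff_derivable.
rewrite -[LHS]/('D_1 (f \o c) s) derive_comp//.
suff -> : 'D_1 c s = u by [].
by rewrite deriveE// diff_val -[LHS]/(1 *: u + 0) scale1r addr0.
Qed.

(** The mean value theorem is applied twice: to the increment of [f] along [h *: v] as a function of
    the coefficient of [u], then to ['D_u f] as a function of the coefficient of [v]. *)
Lemma second_difference (A : set V) (f : V -> R) (x u v : V) (h : R) : 0 < h ->
  (forall y, A y -> differentiable f y) ->
  (forall y, A y -> differentiable ('D_u f) y) ->
  (forall s t : R, 0 <= s <= h -> 0 <= t <= h -> A (s *: u + (t *: v + x))) ->
  exists s t : R, [/\ 0 <= s <= h, 0 <= t <= h &
    f (h *: u + (h *: v + x)) - f (h *: u + x) - (f (h *: v + x) - f x) =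
    h * (h * 'D_v ('D_u f) (s *: u + (t *: v + x)))].
Proof.
move=> h0 df ddf sA.
have hh : 0 <= h <= h by rewrite ltW//=.
have h00 : 0 <= (0 : R) <= h by rewrite lexx ltW.
pose F (s : R) := f (s *: u + (h *: v + x)) - f (s *: u + x).
have dF (s : R) : 0 <= s <= h -> is_derive s 1 F
    ('D_u f (s *: u + (h *: v + x)) - 'D_u f (s *: u + x)).
  move=> sh; apply: is_deriveB; apply: is_derive_line; apply: df.
    exact: sA.
  by have := sA s 0 sh h00; rewrite scale0r add0r.
have cts (G dG : R -> R) : (forall s, 0 <= s <= h -> is_derive s 1 G (dG s)) ->
    {within `[0, h], continuous G}.
  move=> GdG; apply: derivable_within_continuous => s.
  by rewrite in_itv/= => /GdG [].
have itv (s : R) : s \in `]0, h[ -> 0 <= s <= h.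
  by rewrite in_itv/= => /andP[/ltW-> /ltW->].
have [s sh Fs] := MVT h0 (fun s hs => dF s (itv s hs)) (cts _ _ dF).
pose H (t : R) := 'D_u f (t *: v + (s *: u + x)).
have dH (t : R) : 0 <= t <= h ->
    is_derive t 1 H ('D_v ('D_u f) (t *: v + (s *: u + x))).
  move=> th; have E : t *: v + (s *: u + x) = s *: u + (t *: v + x).
    by rewrite addrCA.
  by apply: is_derive_line; apply: ddf; rewrite E; apply: sA => //; exact: itv.
have [t th Ht] := MVT h0 (fun s hs => dH s (itv s hs)) (cts _ _ dH).
exists s, t; split; [exact: itv|exact: itv|].
have FE : f (h *: u + (h *: v + x)) - f (h *: u + x) - (f (h *: v + x) - f x) =
    F h - F 0 by rewrite /F !scale0r !add0r.
have HE : 'D_u f (s *: u + (h *: v + x)) - 'D_u f (s *: u + x) = H h - H 0.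
  by rewrite /H scale0r add0r (addrCA (h *: v)).
by rewrite FE Fs HE Ht !subr0 (addrCA (s *: u)) mulrC (mulrC _ h).
Qed.

(* Both [a] and [b] are mixed second derivatives at intermediate points of the
   same second difference [D h], and these points tend to [x]. *)
Lemma eq_of_shared_second_difference (A : set V) (a b : V -> R) (D : R -> R)
    (x u v : V) : open A -> A x ->
  (forall h : R, 0 < h ->
    (forall s t : R, 0 <= s <= h -> 0 <= t <= h -> A (s *: u + (t *: v + x))) ->
    exists s t : R, [/\ 0 <= s <= h, 0 <= t <= h &
      D h = h * (h * a (s *: u + (t *: v + x)))]) ->
  (forall h : R, 0 < h ->
    (forall s t : R, 0 <= s <= h -> 0 <= t <= h -> A (s *: v + (t *: u + x))) ->
    exists s t : R, [/\ 0 <= s <= h, 0 <= t <= h &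
      D h = h * (h * b (s *: v + (t *: u + x)))]) ->
  {for x, continuous a} -> {for x, continuous b} -> a x = b x.
Proof.
move=> oA Ax sa sb ca cb.
apply/eqP; rewrite -subr_eq0; apply/negPn/negP => d0.
have e0 : 0 < `|a x - b x| / 2 by rewrite divr_gt0 ?normr_gt0.
have na : \forall y \near x, `|a x - a y| < `|a x - b x| / 2.
  by move/cvgrPdist_lt: ca; exact.
have nb : \forall y \near x, `|b x - b y| < `|a x - b x| / 2.
  by move/cvgrPdist_lt: cb; exact.
have nA : \forall y \near x, A y by exact: open_nbhs_nbhs.
have /nbhs_ballP[r r0 rA] : \forall y \near x, [/\ A y,
    `|a x - a y| < `|a x - b x| / 2 & `|b x - b y| < `|a x - b x| / 2].
  by apply: filterS3 nA na nb => y; split.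
(* With this size the whole parallelogram with sides [h *: u] and [h *: v] at [x] lies in the ball
   of radius [r]; the summand 1 keeps the denominator positive when [u] and [v] vanish. *)
pose h := r / (`|u| + `|v| + 1).
have uv0 : 0 < `|u| + `|v| + 1 by rewrite ltr_wpDl// addr_ge0.
have h0 : 0 < h by rewrite divr_gt0.
have inB (s t : R) (u' v' : V) : `|u'| + `|v'| = `|u| + `|v| ->
    0 <= s <= h -> 0 <= t <= h -> ball x r (s *: u' + (t *: v' + x)).
  move=> uvE /andP[s0 sh] /andP[t0 th]; rewrite -ball_normE/= addrA distrC addrK.
  apply: (le_lt_trans (ler_normD _ _)); rewrite !normrZ !ger0_norm//.
  apply: (@le_lt_trans _ _ (h * (`|u'| + `|v'|))).
    by rewrite mulrDr lerD// ler_wpM2r.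
  by rewrite uvE /h mulrAC ltr_pdivrMr// ltr_pM2l// ltrDl.
have sA (s t : R) sh th := rA _ (inB s t u v erefl sh th).
have sA' (s t : R) sh th := rA _ (inB s t v u (addrC _ _) sh th).
have [s [t [sh th E]]] :=
  sa h h0 (fun s t sh th => let: And3 H _ _ := sA s t sh th in H).
have [s' [t' [sh' th' E']]] :=
  sb h h0 (fun s t sh th => let: And3 H _ _ := sA' s t sh th in H).
have [_ Ba _] := sA _ _ sh th; have [_ _ Bb] := sA' _ _ sh' th'.
have EE : a (s *: u + (t *: v + x)) = b (s' *: v + (t' *: u + x)).
  apply/(mulfI (lt0r_neq0 h0))/(mulfI (lt0r_neq0 h0)); rewrite -E -E'.
  by [].
have : `|a x - b x| < `|a x - b x| by
  rewrite [ltRHS]splitr (le_lt_trans _ (ltrD Ba Bb))// EE (distrC (b x)) ler_distD.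
by rewrite ltxx.
Qed.

(** The second difference is symmetric in [u] and [v], so [second_difference] expresses it through
    either mixed derivative. *)
Lemma derive_swap (A : set V) (f : V -> R) (x u v : V) : open A -> A x ->
  (forall y, A y -> differentiable f y) ->
  (forall y, A y -> differentiable ('D_u f) y) ->
  (forall y, A y -> differentiable ('D_v f) y) ->
  {for x, continuous ('D_v ('D_u f))} -> {for x, continuous ('D_u ('D_v f))} ->
  'D_v ('D_u f) x = 'D_u ('D_v f) x.
Proof.
move=> oA Ax df duf dvf.
apply: (@eq_of_shared_second_difference A ('D_v ('D_u f)) ('D_u ('D_v f))
  (fun h => f (h *: u + (h *: v + x)) - f (h *: u + x) - (f (h *: v + x) - f x))
  x u v oA Ax) => h h0 hA.
  exact: (@second_difference A f x u v h h0 df duf hA).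
have [s [t [sh th E]]] := @second_difference A f x v u h h0 df dvf hA.
exists s, t; split=> //; rewrite -E (addrCA (h *: u)) !opprD !opprK !addrA.
by rewrite -!addrA; congr (_ + _); rewrite addrCA.
Qed.

(** * Closure properties of C^k maps *)

Section Smooth.
Context {W : normedModType R}.
Implicit Types (A : set V) (f g : V -> W).

Lemma Ck_ext k A f g : open A -> (forall x, A x -> f x = g x) ->
  Ck k A f -> Ck k A g.
Proof.
move=> oA; elim: k f g => [|k IH] f g fg /=.
  move=> cf x Ax; have fgx : {near x, f =1 g} by exact: near_open fg.
  have := cf _ Ax; rewrite /prop_for /continuous_at (fg _ Ax).
  by apply: cvg_trans; exact: near_eq_cvg fgx.
move=> [df cf]; split=> [x Ax|v].
  by apply: near_eq_differentiable (df _ Ax); exact: near_open fg.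
apply: IH (cf v) => x Ax; apply: near_eq_derive; exact: near_open fg.
Qed.

Lemma CkW k A f : Ck k.+1 A f -> Ck k A f.
Proof.
elim: k f => [|k IH] f /= [df cf].
  by move=> x Ax; apply: differentiable_continuous; exact: df.
by split=> // v; exact: IH.
Qed.

Lemma CkD k A f g : open A -> Ck k A f -> Ck k A g -> Ck k A (f \+ g).
Proof.
move=> oA; elim: k f g => [|k IH] f g /=.
  by move=> cf cg x Ax; apply: continuousD; [exact: cf|exact: cg].
move=> [df cf] [dg cg]; split=> [x Ax|v].
  by apply: differentiableD; [exact: df|exact: dg].
apply: Ck_ext (IH _ _ (cf v) (cg v)) => // x Ax /=.
by rewrite -[RHS]/('D_v (f + g) x) deriveD//;
  apply: diff_derivable; [exact: df|exact: dg].
Qed.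

Lemma Ck_cst k A (c : W) : Ck k A (fun=> c).
Proof.
elim: k c => [|k IH] c /=; first by move=> x _; exact: cvg_cst.
split=> [x _|v]; first exact: differentiable_cst.
have -> : (fun x => 'D_v (fun=> c) x) = fun=> 0 :> W.
  by apply/funext => x; rewrite -[LHS]/('D_v (cst c) x) derive_cst.
exact: IH.
Qed.

End Smooth.

Lemma Ck_linear {W W' : normedModType R} (l : {linear W -> W'}) k A (f : V -> W) :
  open A -> continuous l -> Ck k A f -> Ck k A (l \o f).
Proof.
move=> oA cl; elim: k f => [|k IH] f /=.
  by move=> cf x Ax; apply: continuous_comp; [exact: cf|exact: cl].
have dl y : differentiable l y by exact: linear_differentiable.
move=> [df cf]; split=> [x Ax|v].
  by apply: differentiable_comp => //; exact: df.
apply: Ck_ext (IH _ (cf v)) => // x Ax /=.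
rewrite [RHS](@derive_comp V W W' f l)//; last exact: df.
by rewrite [RHS]deriveE// diff_lin.
Qed.

Lemma CkM k A (f g : V -> R) : open A -> Ck k A f -> Ck k A g ->
  Ck k A (f \* g).
Proof.
move=> oA; elim: k f g => [|k IH] f g.
  by move=> /= cf cg x Ax; apply: continuousM; [exact: cf|exact: cg].
move=> Cf Cg; have [df cf] := Cf; have [dg cg] := Cg; split=> [x Ax|v].
  by apply: differentiableM; [exact: df|exact: dg].
(* The product rule pairs a derivative with an undifferentiated factor, so [CkW] brings [f] and [g]
   down to the order of their derivatives. *)
apply: Ck_ext (CkD oA (IH _ _ (CkW Cf) (cg v)) (IH _ _ (CkW Cg) (cf v))) => //.
move=> x Ax /=.
by rewrite -[RHS]/('D_v (f * g) x) deriveM//;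
  apply: diff_derivable; [exact: df|exact: dg].
Qed.

Lemma CkV k A (f : V -> R) : open A -> (forall x, A x -> f x != 0) ->
  Ck k A f -> Ck k A (fun x => (f x)^-1).
Proof.
move=> oA f0; elim: k => [|k IH] Cf.
  by move=> x Ax /=; apply: cvgV; [exact: f0|exact: Cf].
have [df cf] := Cf; have IHf := IH (CkW Cf); split=> [x Ax|v].
  by apply: differentiableV; [exact: df|exact: f0].
apply: Ck_ext (CkM oA (@Ck_cst R k A (-1 : R)) (CkM oA (CkM oA IHf IHf) (cf v))) => //.
move=> x Ax /=.
rewrite -[RHS]/('D_v (fun y => (f y)^-1) x) deriveV//; last 2 first.
  exact: f0.
  exact/diff_derivable/df.
by rewrite /GRing.scale/= expr2 invfM mulN1r mulNr.
Qed.

End Calculus.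

Section SmoothOn.
Context {R : realType} {V : normedModType R}.
Variable A : set V.
Hypothesis oA : open A.

Lemma smooth_onS {W : normedModType R} (B : set V) (f : V -> W) :
  A `<=` B -> smooth_on B f -> smooth_on A f.
Proof.
move=> AB sf k; move/(_ k): sf.
elim: k f => [|k IH] f /=; first by move=> cf x /AB; exact: cf.
by move=> [df cf]; split=> [x /AB /df|v]//; exact: IH.
Qed.

Section Module.
Context {W : normedModType R}.
Implicit Types f g : V -> W.

Lemma smooth_on_ext f g : (forall x, A x -> f x = g x) ->
  smooth_on A f -> smooth_on A g.
Proof. by move=> fg sf k; exact: Ck_ext (sf k). Qed.

Lemma smooth_on_differentiable f x : smooth_on A f -> A x -> differentiable f x.
Proof. by move=> /(_ 1%N) [+ _]; exact. Qed.

Lemma smooth_on_derive f v : smooth_on A f -> smooth_on A ('D_v f).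
Proof. by move=> sf k; have [_] := sf k.+1; exact. Qed.

Lemma smooth_on_cst (c : W) : smooth_on A (fun=> c).
Proof. by move=> k; exact: Ck_cst. Qed.

Lemma smooth_onD f g : smooth_on A f -> smooth_on A g ->
  smooth_on A (fun x => f x + g x).
Proof. by move=> sf sg k; exact: CkD. Qed.

Lemma smooth_on_sum (I : finType) (P : pred I) (f : I -> V -> W) :
  (forall i, smooth_on A (f i)) -> smooth_on A (fun x => \sum_(i | P i) f i x).
Proof.
move=> sf; have -> : (fun x => \sum_(i | P i) f i x) = \sum_(i | P i) f i.
  by apply/funext => x; rewrite fct_sumE.
elim/big_ind: _ => [|g h sg sh|i _]; [exact: smooth_on_cst| |exact: sf].
exact: smooth_onD.
Qed.

End Module.

Lemma smooth_onM (f g : V -> R) : smooth_on A f -> smooth_on A g ->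
  smooth_on A (fun x => f x * g x).
Proof. by move=> sf sg k; exact: CkM. Qed.

Lemma smooth_onV (f : V -> R) : (forall x, A x -> f x != 0) ->
  smooth_on A f -> smooth_on A (fun x => (f x)^-1).
Proof. by move=> f0 sf k; exact: CkV. Qed.

Lemma smooth_on_prod (I : finType) (f : I -> V -> R) :
  (forall i, smooth_on A (f i)) -> smooth_on A (fun x => \prod_i f i x).
Proof.
move=> sf; rewrite /index_enum; elim: (locked_with _ _) => [|i r IH].
  by under eq_fun do rewrite big_nil; exact: smooth_on_cst.
by under eq_fun do rewrite big_cons; exact: smooth_onM.
Qed.

Lemma smooth_on_rVP n (f : V -> 'rV[R]_n) :
  smooth_on A f <-> forall j, smooth_on A (fun x => f x 0 j).
Proof.
split=> [sf j k|sf].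
  pose l (N : 'rV[R]_n) : R := N 0 j.
  have lin_l : linear l by move=> c u w; rewrite /l !mxE.
  pose ll : {linear _ -> _} := HB.pack l (GRing.isLinear.Build _ _ _ _ _ lin_l).
  exact: (@Ck_linear _ _ _ _ ll k A f oA (@coord_continuous _ _ _ 0 j) (sf k)).
apply: (@smooth_on_ext _ (fun x => \sum_j f x 0 j *: delta_mx 0 j)).
  by move=> x _; rewrite -row_sum_delta.
apply: smooth_on_sum => j k.
pose l (c : R) : 'rV[R]_n := c *: delta_mx 0 j.
have lin_l : linear l by move=> c u w; rewrite /l scalerDl scalerA.
pose ll : {linear _ -> _} := HB.pack l (GRing.isLinear.Build _ _ _ _ _ lin_l).
apply: (@Ck_linear _ _ _ _ ll k A (fun x => f x 0 j) oA); last exact: sf.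
exact: scalel_continuous.
Qed.

Lemma smooth_on_det n (M : V -> 'M[R]_n) :
  (forall i j, smooth_on A (fun x => M x i j)) -> smooth_on A (fun x => \det (M x)).
Proof.
move=> sM; apply: smooth_on_sum => s; apply: smooth_onM.
  exact: smooth_on_cst.
exact: smooth_on_prod.
Qed.

(** By Cramer's formula an entry of the inverse is a cofactor divided by the determinant. *)
Lemma smooth_on_invmx n (M : V -> 'M[R]_n) :
  (forall x, A x -> M x \in unitmx) ->
  (forall i j, smooth_on A (fun x => M x i j)) ->
  forall i j, smooth_on A (fun x => invmx (M x) i j).
Proof.
move=> uM sM i j.
apply: (@smooth_on_ext _ (fun x => (\det (M x))^-1 * cofactor (M x) j i)).
  by move=> x Ax; rewrite /invmx uM// !mxE.
apply: smooth_onM.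
  apply: smooth_onV; last exact: smooth_on_det.
  by move=> x /uM; rewrite unitmxE unitfE.
apply: smooth_onM; first exact: smooth_on_cst.
apply: smooth_on_det => k l.
by under eq_fun do rewrite !mxE; exact: sM.
Qed.

Lemma derive_sum_mul (n : nat) (f g : 'I_n -> V -> R) x v :
  (forall i, differentiable (f i) x) -> (forall i, differentiable (g i) x) ->
  'D_v (fun y => \sum_i f i y * g i y) x =
  \sum_i ('D_v (f i) x * g i x + f i x * 'D_v (g i) x).
Proof.
move=> df dg; have -> : (fun y => \sum_i f i y * g i y) = \sum_i (f i * g i).
  by apply/funext => y; rewrite fct_sumE.
rewrite derive_sum; last first.
  by move=> i; apply: derivableM; apply: diff_derivable.
apply: eq_bigr => i _; rewrite deriveM; [|exact: diff_derivable..].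
by rewrite addrC mulrC.
Qed.

End SmoothOn.

Lemma derive_coord {R : realType} {d : nat} (f : 'rV[R]_d -> R) x v :
  differentiable f x -> 'D_v f x = \sum_j v 0 j * 'D_(delta_mx 0 j) f x.
Proof.
move=> df; rewrite {1}(row_sum_delta v) derive_sumE//.
by apply: eq_bigr => j _; rewrite derive_scaleE.
Qed.

(** * Derivatives and brackets in charts *)

Section Manifold.
Context {R : realType} {d : nat} {M : manifold R d}.
Implicit Types (U : set M) (X Y Z : vector_field M) (F G : M -> R) (p q : M).

Local Notation phi_ p := (phi (chart_at p)).
Local Notation psi_ p := (psi (chart_at p)).
Local Notation dom_ p := (dom (chart_at p)).

Lemma psi_phi p q : dom_ p q -> psi_ p (phi_ p q) = q.
Proof. exact: phiK. Qed.

Lemma open_chart_image p U : open U -> open (chart_image p U).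
Proof.
(* In this form openness follows from the open image of the chart and the continuity of [psi] on
   it. *)
move=> oU; rewrite (_ : chart_image p U = (phi_ p @` dom_ p) `&` psi_ p @^-1` U).
  rewrite openE => x [dx Ux]; apply: filterI.
    by apply: open_nbhs_nbhs; split=> //; exact: open_phi_dom.
  by apply: (psi_continuous dx); exact: open_nbhs_nbhs.
apply/seteqP; split=> [x [q [dq Uq] <-]|x [[q dq <-]]] /=.
  by rewrite psi_phi//; split=> //; exists q.
by rewrite psi_phi// => Uq; exists q.
Qed.

Arguments open_chart_image p [U] oU.

Lemma mem_chart_image p q U : dom_ p q -> U q -> chart_image p U (phi_ p q).
Proof. by move=> dq Uq; exists q. Qed.

Lemma mem_chart_imageT p x : chart_image p setT x ->
  dom_ p (psi_ p x) /\ phi_ p (psi_ p x) = x.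
Proof. by move=> [q [dq _] <-]; rewrite psi_phi. Qed.

Lemma chart_imageW p U x : chart_image p U x -> chart_image p setT x.
Proof. by move=> [q [dq _] <-]; exists q. Qed.

Lemma chart_image_psi p U x : chart_image p U x -> U (psi_ p x).
Proof. by move=> [q [dq Uq] <-]; rewrite psi_phi. Qed.

Section SmoothFun.
Variable U : set M.
Hypothesis oU : open U.

Lemma smooth_fun_ext F G : (forall q, U q -> F q = G q) ->
  smooth_fun U F -> smooth_fun U G.
Proof.
move=> FG sF p; apply: smooth_on_ext (sF p); first exact: open_chart_image.
by move=> x /chart_image_psi /FG.
Qed.

Lemma smooth_fun_cst (c : R) : smooth_fun U (fun=> c).
Proof. by move=> p; exact: smooth_on_cst. Qed.

Lemma smooth_funD F G : smooth_fun U F -> smooth_fun U G ->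
  smooth_fun U (fun q => F q + G q).
Proof. by move=> sF sG p; apply: smooth_onD (sF p) (sG p); exact: open_chart_image. Qed.

Lemma smooth_funM F G : smooth_fun U F -> smooth_fun U G ->
  smooth_fun U (fun q => F q * G q).
Proof. by move=> sF sG p; apply: smooth_onM (sF p) (sG p); exact: open_chart_image. Qed.

Lemma smooth_fun_sum (I : finType) (F : I -> M -> R) :
  (forall i, smooth_fun U (F i)) -> smooth_fun U (fun q => \sum_i F i q).
Proof.
move=> sF p; have := smooth_on_sum (open_chart_image p oU) predT (fun i => sF i p).
by [].
Qed.

Lemma smooth_fun_differentiable F p : smooth_fun U F -> U p ->
  differentiable (F \o psi_ p) (phi_ p p).
Proof.
move=> sF Up; apply: smooth_on_differentiable (sF p) _.
by apply: mem_chart_image => //; exact: dom_chart_at.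
Qed.

Lemma lie_deriv_eq X F G p : (forall q, U q -> F q = G q) -> U p ->
  lie_deriv X F p = lie_deriv X G p.
Proof.
move=> FG Up; apply: near_eq_derive.
apply: near_open (open_chart_image p oU) (mem_chart_image (dom_chart_at p) Up) _.
by move=> x /chart_image_psi /FG.
Qed.

Lemma lie_deriv_sumM (I : nat) X (F G : 'I_I -> M -> R) p :
  (forall i, smooth_fun U (F i)) -> (forall i, smooth_fun U (G i)) -> U p ->
  lie_deriv X (fun q => \sum_i F i q * G i q) p =
  \sum_i (lie_deriv X (F i) p * G i p + F i p * lie_deriv X (G i) p).
Proof.
move=> sF sG Up.
have /= := @derive_sum_mul R _ I (fun i => F i \o psi_ p) (fun i => G i \o psi_ p)
  (phi_ p p) (X p) (fun i => smooth_fun_differentiable (sF i) Up)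
  (fun i => smooth_fun_differentiable (sG i) Up).
rewrite /lie_deriv => ->; apply: eq_bigr => i _.
by rewrite psi_phi//; exact: dom_chart_at.
Qed.

Lemma lie_derivD X F G p : smooth_fun U F -> smooth_fun U G -> U p ->
  lie_deriv X (fun q => F q + G q) p = lie_deriv X F p + lie_deriv X G p.
Proof.
by move=> sF sG Up; apply: deriveD; apply: diff_derivable;
  exact: smooth_fun_differentiable.
Qed.

Lemma lie_derivM X F G p : smooth_fun U F -> smooth_fun U G -> U p ->
  lie_deriv X (fun q => F q * G q) p =
  lie_deriv X F p * G p + F p * lie_deriv X G p.
Proof.
move=> sF sG Up.
have := @lie_deriv_sumM 1 X (fun=> F) (fun=> G) p (fun=> sF) (fun=> sG) Up.
rewrite big_ord1 => <-; apply: lie_deriv_eq Up => q _.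
by rewrite big_ord1.
Qed.

Lemma lie_deriv_linear X F p (I : finType) (c : I -> R) (Y : I -> vector_field M) :
  smooth_fun U F -> U p -> X p = \sum_i c i *: Y i p ->
  lie_deriv X F p = \sum_i c i * lie_deriv (Y i) F p.
Proof.
move=> sF Up Xp; have dF := smooth_fun_differentiable sF Up.
rewrite /lie_deriv Xp derive_sumE//.
by apply: eq_bigr => i _; rewrite derive_scaleE.
Qed.

End SmoothFun.

Lemma lie_deriv_cst X (c : R) p : lie_deriv X (fun=> c) p = 0.
Proof. exact: (derive_cst c). Qed.

Lemma smooth_fieldS U V X : U `<=` V -> smooth_field V X -> smooth_field U X.
Proof.
move=> UV sX p; apply: smooth_onS (sX p).
by move=> x [q [dq /UV Vq] <-]; exists q.
Qed.

(* The change of charts at [q = psi_ p x], from the preferred chart at [q] to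
   the chart at [p]. *)
Definition trans_mx p (x : 'rV[R]_d) : 'M[R]_d :=
  jacobian (phi_ p \o psi_ (psi_ p x)) (phi_ (psi_ p x) (psi_ p x)).

Definition overlap p q : set 'rV[R]_d := phi_ p @` (dom_ p `&` dom_ q).

Lemma open_overlap p q : open (overlap p q).
Proof. by apply: (@open_chart_image p (dom_ q)); exact: open_dom. Qed.

Arguments open_overlap p q : clear implicits.

Lemma transition_differentiable p q r : dom_ p r -> dom_ q r ->
  differentiable (phi_ q \o psi_ p) (phi_ p r).
Proof.
move=> pr qr; apply: smooth_on_differentiable (@smooth_transition _ _ M p q) _.
by exists r.
Qed.

Lemma in_chartE p X x : chart_image p setT x ->
  in_chart p X x = X (psi_ p x) *m trans_mx p x.
Proof.
move=> /mem_chart_imageT[dx _]; rewrite /in_chart deriveEjacobian//.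
by apply: transition_differentiable => //; exact: dom_chart_at.
Qed.

Lemma derive_transitionK p q r v : dom_ p r -> dom_ q r ->
  'D_('D_v (phi_ q \o psi_ p) (phi_ p r)) (phi_ p \o psi_ q) (phi_ q r) = v.
Proof.
move=> pr qr.
have E : (phi_ q \o psi_ p) (phi_ p r) = phi_ q r by rewrite /= psi_phi.
have dpq := transition_differentiable pr qr.
have dqp := transition_differentiable qr pr.
rewrite -E -derive_comp//; last by rewrite E.
rewrite -[RHS](derive_id (phi_ p r) v); apply: near_eq_derive.
apply: near_open (open_overlap p q) _ _; first by exists r.
by move=> x [s [ps qs] <-] /=; rewrite !psi_phi.
Qed.

Lemma trans_mx_unit p x : chart_image p setT x -> trans_mx p x \in unitmx.
Proof.
move=> /mem_chart_imageT[dx xE].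
set q := psi_ p x in dx xE; have dq : dom_ q q by exact: dom_chart_at.
have [+ _] : trans_mx p x \in unitmx /\
    jacobian (phi_ q \o psi_ p) (phi_ p q) \in unitmx; last by [].
apply/mulmx1_unit/row_matrixP => i; rewrite !rowE mulmxA mulmx1.
rewrite /trans_mx -/q -!deriveEjacobian; last 2 first.
- exact: transition_differentiable.
- exact: transition_differentiable.
exact: derive_transitionK.
Qed.

Lemma in_chart_id p X : in_chart p X (phi_ p p) = X p.
Proof.
have dp := dom_chart_at p; rewrite /in_chart psi_phi//.
rewrite -[RHS](derive_id (phi_ p p) (X p)); apply: near_eq_derive.
apply: near_open (open_overlap p p) _ _; first by exists p.
by move=> x [s [ps qs] <-] /=; rewrite !psi_phi.
Qed.

Lemma smooth_field_in_chart U X p : smooth_field U X -> U p ->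
  differentiable (in_chart p X) (phi_ p p).
Proof.
move=> sX Up; apply: smooth_on_differentiable (sX p) _.
by apply: mem_chart_image => //; exact: dom_chart_at.
Qed.

(** [lie_deriv X F] is defined through a different chart at each point. The chain rule moves it to
    one fixed chart, where it can be differentiated again. *)
Lemma lie_deriv_chart U X F p x : open U -> smooth_fun U F ->
  chart_image p U x ->
  lie_deriv X F (psi_ p x) = 'D_(in_chart p X x) (F \o psi_ p) x.
Proof.
move=> oU sF Ux; have [dx xE] := mem_chart_imageT (chart_imageW Ux).
have Uq := chart_image_psi Ux.
rewrite /lie_deriv /in_chart; set q := psi_ p x in dx xE Uq *.
have dq : dom_ q q by exact: dom_chart_at.
have E : (phi_ p \o psi_ q) (phi_ q q) = x by rewrite /= psi_phi.
rewrite -[in RHS]E -derive_comp; last 2 first.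
- exact: transition_differentiable.
- by rewrite E; apply: smooth_on_differentiable (sF p) _.
apply: near_eq_derive; apply: near_open (open_overlap q p) _ _; first by exists q.
by move=> y [s [ps qs] <-] /=; rewrite !psi_phi.
Qed.

Lemma lie_deriv_chart_sum U X F p x : open U -> smooth_fun U F ->
  chart_image p U x ->
  lie_deriv X F (psi_ p x) =
  \sum_j in_chart p X x 0 j * 'D_(delta_mx 0 j) (F \o psi_ p) x.
Proof.
move=> oU sF Ux; rewrite (lie_deriv_chart X oU)//.
apply: derive_coord.
exact: smooth_on_differentiable (sF p) Ux.
Qed.

Lemma smooth_lie_deriv U X F : open U -> smooth_field U X -> smooth_fun U F ->
  smooth_fun U (lie_deriv X F).
Proof.
move=> oU sX sF p; have oA := open_chart_image p oU.
apply: (smooth_on_ext oA) => [x Ux|].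
  exact/esym/(lie_deriv_chart_sum X oU sF Ux).
apply: smooth_on_sum => // j; apply: smooth_onM => //.
  exact: (smooth_on_rVP oA _).1 (sX p) j.
exact: smooth_on_derive (sF p).
Qed.

Lemma derive_row n (f : 'rV[R]_d -> 'rV[R]_n) x v j : differentiable f x ->
  ('D_v f x) 0 j = 'D_v (fun y => f y 0 j) x.
Proof.
by move=> df; rewrite derive_mx ?mxE//; exact: diff_derivable.
Qed.

(** In a fixed chart, differentiating [Y F] along [X] gives first-order terms with the derivative of
    the components of [Y], plus second derivatives of [F] contracted with [X] and [Y]. The latter
    are symmetric by [derive_swap] and cancel; the former make up the bracket. *)
Lemma lie_bracket_commutator U X Y F p : open U -> smooth_field U X ->
  smooth_field U Y -> smooth_fun U F -> U p ->
  lie_deriv (lie_bracket X Y) F p =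
  lie_deriv X (lie_deriv Y F) p - lie_deriv Y (lie_deriv X F) p.
Proof.
move=> oU sX sY sF Up; have dp := dom_chart_at p.
have oA := open_chart_image p oU; have Ap := mem_chart_image dp Up.
pose f := F \o psi_ p; pose e j : 'rV[R]_d := delta_mx 0 j.
have sf : smooth_on (chart_image p U) f by exact: sF.
have second Z T : smooth_field U T ->
    lie_deriv Z (lie_deriv T F) p =
    \sum_j (('D_(Z p) (in_chart p T) (phi_ p p)) 0 j * 'D_(e j) f (phi_ p p)
      + T p 0 j * 'D_(Z p) ('D_(e j) f) (phi_ p p)).
  move=> sT; rewrite {1}/lie_deriv.
  have -> : 'D_(Z p) (lie_deriv T F \o psi_ p) (phi_ p p) =
      'D_(Z p) (fun x => \sum_j in_chart p T x 0 j * 'D_(e j) f x) (phi_ p p).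
    apply: near_eq_derive; apply: (near_open oA Ap) => x Ax.
    exact: lie_deriv_chart_sum Ax.
  have sTj j := (smooth_on_rVP oA (in_chart p T)).1 (sT p) j.
  rewrite (derive_sum_mul (f := fun j x => in_chart p T x 0 j)); last 2 first.
  - by move=> j; exact: smooth_on_differentiable (sTj j) Ap.
  - by move=> j; exact: smooth_on_differentiable (smooth_on_derive _ sf) Ap.
  apply: eq_bigr => j _; rewrite in_chart_id derive_row//.
  exact: smooth_field_in_chart Up.
have sec (Z T : vector_field M) :
    \sum_j T p 0 j * 'D_(Z p) ('D_(e j) f) (phi_ p p) =
    \sum_j \sum_i T p 0 j * (Z p 0 i * 'D_(e i) ('D_(e j) f) (phi_ p p)).
  apply: eq_bigr => j _; rewrite -mulr_sumr; congr (_ * _).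
  apply: derive_coord.
  exact: smooth_on_differentiable (smooth_on_derive _ sf) Ap.
have swap i j : 'D_(e j) ('D_(e i) f) (phi_ p p) = 'D_(e i) ('D_(e j) f) (phi_ p p).
  have s1 k y : chart_image p U y -> differentiable ('D_(e k) f) y.
    by apply: smooth_on_differentiable; exact: smooth_on_derive.
  have s2 k l : {for phi_ p p, continuous ('D_(e l) ('D_(e k) f))}.
    apply: differentiable_continuous; apply: smooth_on_differentiable Ap.
    by apply: smooth_on_derive; exact: smooth_on_derive.
  have s0 y : chart_image p U y -> differentiable f y.
    exact: smooth_on_differentiable.
  exact: (@derive_swap _ _ _ f _ (e i) (e j) oA Ap s0 (s1 i) (s1 j) (s2 _ _) (s2 _ _)).
have XY : \sum_j Y p 0 j * 'D_(X p) ('D_(e j) f) (phi_ p p) =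
    \sum_j X p 0 j * 'D_(Y p) ('D_(e j) f) (phi_ p p).
  apply: etrans (sec X Y) _; apply: etrans _ (esym (sec Y X)).
  apply: etrans (exchange_big _ _ _ _ _ _) _ => /=.
  by apply: eq_bigr => i _; apply: eq_bigr => j _; rewrite mulrCA (swap i j).
have sumB (a b c b' : 'I_d -> R) : \sum_j b j = \sum_j b' j ->
    \sum_j (a j + b j) - \sum_j (c j + b' j) = \sum_j (a j - c j).
  by move=> bb; rewrite !big_split/= bb opprD addrACA subrr addr0 sumrN.
transitivity (\sum_j (('D_(X p) (in_chart p Y) (phi_ p p)) 0 j * 'D_(e j) f (phi_ p p)
    - ('D_(Y p) (in_chart p X) (phi_ p p)) 0 j * 'D_(e j) f (phi_ p p))); last first.
  by apply: etrans (esym (sumB _ _ _ _ XY)) _; congr (_ - _); apply/esym/second.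
have df : differentiable f (phi_ p p) by exact: smooth_on_differentiable sf Ap.
apply: etrans (derive_coord _ df) _; apply: eq_bigr => j _.
by rewrite -mulrBl; congr (_ * _); rewrite /lie_bracket !mxE.
Qed.

End Manifold.

(** This lemma and the next two open a single matrix operation, where [mxE] would also open products
    and transposes. *)
Lemma addmxE {V : nmodType} m n (A B : 'M[V]_(m, n)) i j :
  (A + B) i j = A i j + B i j.
Proof. by rewrite mxE. Qed.

Lemma oppmxE {V : zmodType} m n (A : 'M[V]_(m, n)) i j : (- A) i j = - A i j.
Proof. by rewrite mxE. Qed.

Lemma scalemxE {V : pzRingType} m n c (A : 'M[V]_(m, n)) i j :
  (c *: A) i j = c * A i j.
Proof. by rewrite mxE. Qed.

(** * Frames with constant structure coefficients *)

Section Frame.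
Context {R : realType} {d : nat} {M : manifold R d}.
Variable E : 'I_d -> vector_field M.
Implicit Types (U : set M) (X Y Z : vector_field M) (p q : M) (y z : M -> 'rV[R]_d).

(* The rows are the frame vectors, so that the components [comp X] of a field
   satisfy [X q = comp X q *m frame_mx q]. *)
Definition frame_mx q : 'M[R]_d := \matrix_(i, k) E i q 0 k.

Hypothesis smooth_frame : forall i, smooth_field setT (E i).
Hypothesis frame_mx_unit : forall q, frame_mx q \in unitmx.

Definition comp X q : 'rV[R]_d := X q *m invmx (frame_mx q).

Lemma compK X q : comp X q *m frame_mx q = X q.
Proof. exact: mulmxKV. Qed.

Lemma comp_mul y q : comp (fun r => y r *m frame_mx r) q = y q.
Proof. exact: mulmxK. Qed.

Lemma comp_frame i q : comp (E i) q = delta_mx 0 i.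
Proof.
apply: (can_inj (mulmxK (frame_mx_unit q))); rewrite compK -rowE.
by apply/rowP => k; rewrite !mxE.
Qed.

Lemma frame_sum X q : X q = \sum_i comp X q 0 i *: E i q.
Proof.
rewrite -{1}(compK X q) mulmx_sum_row; apply: eq_bigr => i _; congr (_ *: _).
by apply/rowP => j; rewrite !mxE.
Qed.

(** The frame seen in one fixed chart. Its entries are smooth, whereas those of [frame_mx] jump with
    the preferred chart. *)
Let frame_chart p (x : 'rV[R]_d) : 'M[R]_d := \matrix_(i, l) in_chart p (E i) x 0 l.

Lemma frame_chartE p x : chart_image p setT x ->
  frame_chart p x = frame_mx (psi (chart_at p) x) *m trans_mx p x.
Proof.
move=> Ax; apply/row_matrixP => i; rewrite row_mul.
have -> : row i (frame_mx (psi (chart_at p) x)) = E i (psi (chart_at p) x).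
  by apply/rowP => k; rewrite !mxE.
by rewrite -in_chartE//; apply/rowP => k; rewrite !mxE.
Qed.

Lemma frame_chart_unit p x : chart_image p setT x -> frame_chart p x \in unitmx.
Proof.
by move=> Ax; rewrite frame_chartE// unitmx_mul frame_mx_unit trans_mx_unit.
Qed.

(** Field and frame pick up the same factor [trans_mx p x], so the components are the same in every
    chart. *)
Lemma in_chart_comp p X x : chart_image p setT x ->
  in_chart p X x = comp X (psi (chart_at p) x) *m frame_chart p x.
Proof. by move=> Ax; rewrite frame_chartE// mulmxA compK in_chartE. Qed.

Lemma smooth_frame_chart p U i k : open U ->
  smooth_on (chart_image p U) (fun x => frame_chart p x i k).
Proof.
move=> oU; have oA := @open_chart_image R d M p U oU.
have sE : smooth_field U (E i) by apply: smooth_fieldS (smooth_frame i).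
have -> : (fun x => frame_chart p x i k) = (fun x => in_chart p (E i) x 0 k).
  by apply/funext => x; rewrite mxE.
exact: (smooth_on_rVP oA _).1 (sE p) k.
Qed.

(** In a fixed chart the components are the field times the inverse of the frame matrix, and both
    factors are smooth. *)
Lemma smooth_comp U X k : open U -> smooth_field U X ->
  smooth_fun U (fun q => comp X q 0 k).
Proof.
move=> oU sX p; have oA := @open_chart_image R d M p U oU.
apply: (@smooth_on_ext _ _ _ oA _
  (fun x => \sum_l in_chart p X x 0 l * invmx (frame_chart p x) l k)).
  move=> x Ax; have AT := chart_imageW Ax.
  by rewrite /= -(mulmxK (frame_chart_unit AT) (comp X _)) -in_chart_comp// mxE.
apply: smooth_on_sum => // l; apply: smooth_onM => //.
  exact: (smooth_on_rVP oA _).1 (sX p) l.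
apply: smooth_on_invmx => // [x Ax|i j]; last exact: smooth_frame_chart.
exact: frame_chart_unit (chart_imageW Ax).
Qed.

Lemma smooth_of_comp U X : open U ->
  (forall k, smooth_fun U (fun q => comp X q 0 k)) -> smooth_field U X.
Proof.
move=> oU sy p; have oA := @open_chart_image R d M p U oU.
apply/(smooth_on_rVP oA) => l.
apply: (@smooth_on_ext _ _ _ oA _
  (fun x => \sum_k comp X (psi (chart_at p) x) 0 k * frame_chart p x k l)).
  by move=> x Ax; rewrite in_chart_comp ?mxE//; exact: chart_imageW Ax.
apply: smooth_on_sum => // k; apply: smooth_onM => //; first exact: sy.
exact: smooth_frame_chart.
Qed.

Definition lie_row X y : M -> 'rV[R]_d := fun q =>
  \row_k lie_deriv X (fun r => y r 0 k) q.

Definition smooth_row U y := forall k, smooth_fun U (fun q => y q 0 k).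

Section Open.
Variable U : set M.
Hypothesis oU : open U.

Lemma smooth_row_comp X : smooth_field U X -> smooth_row U (comp X).
Proof. by move=> sX k; exact: smooth_comp. Qed.

Lemma smooth_row_lie X y : smooth_field U X -> smooth_row U y ->
  smooth_row U (lie_row X y).
Proof.
move=> sX sy k; have -> : (fun q => lie_row X y q 0 k) =
    lie_deriv X (fun r => y r 0 k) by apply/funext => q; rewrite mxE.
exact: smooth_lie_deriv.
Qed.

Lemma lie_row_eq X y z p : (forall q, U q -> y q = z q) -> U p ->
  lie_row X y p = lie_row X z p.
Proof.
move=> yz Up; apply/rowP => k; rewrite !mxE; apply: (lie_deriv_eq oU) => // q Uq.
by rewrite yz.
Qed.

Lemma lie_rowD X y z p : smooth_row U y -> smooth_row U z -> U p ->
  lie_row X (fun q => y q + z q) p = lie_row X y p + lie_row X z p.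
Proof.
move=> sy sz Up; apply/rowP => k; rewrite !mxE -(lie_derivD _ (sy k) (sz k) Up).
by apply: (lie_deriv_eq oU) => // q _; rewrite mxE.
Qed.

Lemma lie_rowZ X (F : M -> R) y p : smooth_fun U F -> smooth_row U y -> U p ->
  lie_row X (fun q => F q *: y q) p = lie_deriv X F p *: y p + F p *: lie_row X y p.
Proof.
move=> sF sy Up; apply/rowP => k; rewrite !mxE -(lie_derivM oU)//.
by apply: (lie_deriv_eq oU) => // q _; rewrite mxE.
Qed.

Lemma lie_row_sum X Y p (I : finType) (c : I -> R) (V : I -> vector_field M) y :
  smooth_row U y -> U p -> X p = \sum_i c i *: V i p ->
  lie_row X y p = \sum_i c i *: lie_row (V i) y p.
Proof.
move=> sy Up Xp; apply/rowP => k; rewrite mxE summxE (lie_deriv_linear (sy k) Up Xp).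
by apply: eq_bigr => i _; rewrite !mxE.
Qed.

Lemma lie_row_bracket X Y y p : smooth_field U X -> smooth_field U Y ->
  smooth_row U y -> U p ->
  lie_row (lie_bracket X Y) y p = lie_row X (lie_row Y y) p - lie_row Y (lie_row X y) p.
Proof.
move=> sX sY sy Up; apply/rowP => k; rewrite !mxE (lie_bracket_commutator oU)//.
by congr (_ - _); apply: (lie_deriv_eq oU) => // q _; rewrite mxE.
Qed.

Lemma lie_deriv_mul_cst X y (a : 'cV[R]_d) p : smooth_row U y -> U p ->
  lie_deriv X (fun q => (y q *m a) 0 0) p = (lie_row X y p *m a) 0 0.
Proof.
move=> sy Up; rewrite mxE; transitivity
    (lie_deriv X (fun q => \sum_i y q 0 i * (fun i _ => a i 0) i q) p).
  by apply: (lie_deriv_eq oU) => // q _; rewrite mxE.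
rewrite (lie_deriv_sumM _ sy _ Up); last by move=> i; exact: smooth_fun_cst.
by apply: eq_bigr => i _; rewrite lie_deriv_cst mulr0 addr0 mxE.
Qed.

Lemma lie_deriv_dot X y z p : smooth_row U y -> smooth_row U z -> U p ->
  lie_deriv X (fun q => (y q *m (z q)^T) 0 0) p =
  (lie_row X y p *m (z p)^T + y p *m (lie_row X z p)^T) 0 0.
Proof.
move=> sy sz Up; transitivity
    (lie_deriv X (fun q => \sum_i y q 0 i * z q 0 i) p).
  apply: (lie_deriv_eq oU) => // q _; rewrite mxE.
  by apply: eq_bigr => i _; rewrite mxE.
rewrite (lie_deriv_sumM _ sy sz Up) big_split/= !mxE.
by congr (_ + _); apply: eq_bigr => i _; rewrite !mxE.
Qed.

Lemma smooth_row_mulmx y (C : 'M[R]_d) : smooth_row U y ->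
  smooth_row U (fun q => y q *m C).
Proof.
move=> sy k; apply: (@smooth_fun_ext _ _ _ U oU (fun q => \sum_i y q 0 i * C i k)).
  by move=> q _; rewrite mxE.
by apply: smooth_fun_sum => // i; apply: smooth_funM => //; exact: smooth_fun_cst.
Qed.

Lemma smooth_fun_dot y z : smooth_row U y -> smooth_row U z ->
  smooth_fun U (fun q => (y q *m (z q)^T) 0 0).
Proof.
move=> sy sz; apply: (@smooth_fun_ext _ _ _ U oU (fun q => \sum_i y q 0 i * z q 0 i)).
  by move=> q _; rewrite mxE; apply: eq_bigr => i _; rewrite mxE.
by apply: smooth_fun_sum => // i; exact: smooth_funM.
Qed.

Lemma lie_row_mulmx X y (C : 'M[R]_d) p : smooth_row U y -> U p ->
  lie_row X (fun q => y q *m C) p = lie_row X y p *m C.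
Proof.
move=> sy Up; apply/rowP => k; rewrite mxE.
transitivity (lie_deriv X (fun q => (y q *m col k C) 0 0) p).
  apply: (lie_deriv_eq oU) => // q _; rewrite !mxE.
  by apply: eq_bigr => i _; rewrite mxE.
rewrite (lie_deriv_mul_cst _ _ sy Up) [LHS]mxE [RHS]mxE; apply: eq_bigr => i _.
by rewrite [col k C i 0]mxE.
Qed.

End Open.

(** * The Lie bracket in terms of components *)

Section Bracket.
Variable B : 'I_d -> 'I_d -> 'rV[R]_d.
Hypothesis frame_bracket : forall i j p,
  lie_bracket (E i) (E j) p = B i j *m frame_mx p.

Definition br (x y : 'rV[R]_d) : 'rV[R]_d :=
  \sum_i \sum_j (x 0 i * y 0 j) *: B i j.

(** The product rule is applied to [in_chart_comp]. Derivatives of the components give the two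
    [lie_row] terms; derivatives of the frame, antisymmetrized, are the brackets of frame vectors
    and give the bilinear term [br]. *)
Lemma comp_bracket U X Y p : open U -> smooth_field U X -> smooth_field U Y ->
  U p -> comp (lie_bracket X Y) p =
    lie_row X (comp Y) p - lie_row Y (comp X) p + br (comp X p) (comp Y p).
Proof.
move=> oU sX sY Up; have oA := @open_chart_image R d M p U oU.
have dp := dom_chart_at p; have Ap := mem_chart_image dp Up.
have psip : psi (chart_at p) (phi (chart_at p) p) = p by exact: psi_phi.
pose D v k l := 'D_v (fun x => frame_chart p x k l) (phi (chart_at p) p).
have dfc k l : differentiable (fun x => frame_chart p x k l) (phi (chart_at p) p).
  exact: smooth_on_differentiable (@smooth_frame_chart p U k l oU) Ap.
have chartD Z T l : smooth_field U T ->
    ('D_(Z p) (in_chart p T) (phi (chart_at p) p)) 0 l =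
    \sum_k (lie_deriv Z (fun q => comp T q 0 k) p * frame_mx p k l
            + comp T p 0 k * D (Z p) k l).
  move=> sT; rewrite derive_row; last exact: smooth_field_in_chart Up.
  transitivity ('D_(Z p) (fun x =>
      \sum_k ((fun q => comp T q 0 k) \o psi (chart_at p)) x
      * frame_chart p x k l) (phi (chart_at p) p)).
    apply: near_eq_derive; apply: (near_open oA Ap) => x Ax.
    by rewrite in_chart_comp ?mxE//; exact: chart_imageW Ax.
  rewrite (derive_sum_mul (g := fun k x => frame_chart p x k l)) => [|k|k];
    last 2 first.
  - exact: smooth_fun_differentiable (smooth_comp k oU sT) Up.
  - exact: dfc.
  by apply: eq_bigr => k _; rewrite /= psip !mxE in_chart_id.
have DE (Z : vector_field M) k l :
    D (Z p) k l = \sum_i comp Z p 0 i * D (E i p) k l.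
  rewrite /D {1}(frame_sum Z p) derive_sumE//.
  by apply: eq_bigr => i _; rewrite derive_scaleE.
have EE i k l : (B i k *m frame_mx p) 0 l = D (E i p) k l - D (E k p) i l.
  rewrite -frame_bracket /lie_bracket !mxE.
  have row_D v j : ('D_v (in_chart p (E j)) (phi (chart_at p) p)) 0 l = D v j l.
    rewrite derive_row; last first.
      exact: smooth_field_in_chart (smooth_frame j) I.
    have -> // : (fun x => in_chart p (E j) x 0 l) = (fun x => frame_chart p x j l).
    by apply/funext => x; rewrite mxE.
  by congr (_ - _); exact: row_D.
(* From here on the derivatives [D] of the frame matrix matter only through [chartD], their
   linearity [DE] and the bracket relation [EE]. *)
move: D chartD DE EE => D chartD DE EE {dfc}.
apply: (can_inj (mulmxK (frame_mx_unit p))); rewrite compK; apply/rowP => l.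
rewrite !mulmxDl mulNmx.
have brE : (br (comp X p) (comp Y p) *m frame_mx p) 0 l =
    \sum_k comp Y p 0 k * D (X p) k l - \sum_k comp X p 0 k * D (Y p) k l.
  rewrite /br mulmx_suml summxE.
  transitivity (\sum_i \sum_k (comp X p 0 i * comp Y p 0 k * D (E i p) k l
      - comp X p 0 i * comp Y p 0 k * D (E k p) i l)).
    apply: eq_bigr => i _; rewrite mulmx_suml summxE; apply: eq_bigr => k _.
    by rewrite -scalemxAl mxE EE mulrBr.
  under eq_bigr => i _ do rewrite sumrB.
  rewrite sumrB; congr (_ - _).
    rewrite exchange_big/=; apply: eq_bigr => k _; rewrite (DE X) mulr_sumr.
    by apply: eq_bigr => i _; rewrite mulrA (mulrC (comp Y p 0 k)).
  apply: eq_bigr => i _; rewrite (DE Y) mulr_sumr.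
  by apply: eq_bigr => k _; rewrite mulrA.
have rowE Z T : (lie_row Z (comp T) p *m frame_mx p) 0 l =
    \sum_k lie_deriv Z (fun q => comp T q 0 k) p * frame_mx p k l.
  by rewrite mxE; apply: eq_bigr => k _; rewrite mxE.
rewrite /lie_bracket !addmxE !oppmxE.
have sumD (a b c e : 'I_d -> R) : \sum_k (a k + b k) - \sum_k (c k + e k) =
    \sum_k a k - \sum_k c k + (\sum_k b k - \sum_k e k).
  by rewrite !big_split/= opprD addrACA.
apply: etrans (congr2 (fun a b => a - b) (chartD X Y l sY) (chartD Y X l sX)) _.
apply: etrans (sumD _ _ _ _) _; congr (_ - _ + _); apply: esym => //.
Qed.

(** * Connections and forms with constant coefficients *)

Section Connection.
Variable G : 'I_d -> 'M[R]_d.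

(* Row [j] of [G i] holds the components of the derivative of [E j] along [E i]. *)
Definition Gam (x : 'rV[R]_d) : 'M[R]_d := \sum_i x 0 i *: G i.

Fact Gam_linear : linear Gam.
Proof.
move=> c x y; rewrite /Gam scaler_sumr -big_split/=; apply: eq_bigr => i _.
by rewrite !mxE scalerDl scalerA.
Qed.
HB.instance Definition _ := GRing.isLinear.Build _ _ _ _ Gam Gam_linear.

(** The Leibniz rule forces this formula once row [j] of [G i] is taken as the derivative of [E j]
    along [E i]. *)
Definition nabla : @connection R d M := fun X Y q =>
  (lie_row X (comp Y) q + comp Y q *m Gam (comp X q)) *m frame_mx q.

Lemma comp_nabla X Y q :
  comp (nabla X Y) q = lie_row X (comp Y) q + comp Y q *m Gam (comp X q).
Proof. exact: comp_mul. Qed.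

Lemma Gam_delta i : Gam (delta_mx 0 i) = G i.
Proof.
rewrite /Gam (bigD1 i)//= mxE !eqxx scale1r big1 ?addr0// => j ji.
by rewrite mxE (negbTE ji) andbF scale0r.
Qed.

Lemma row_mul_Gam (x y : 'rV[R]_d) :
  y *m Gam x = \sum_i \sum_j (x 0 i * y 0 j) *: row j (G i).
Proof.
rewrite /Gam mulmx_sumr; apply: eq_bigr => i _.
rewrite -scalemxAr mulmx_sum_row scaler_sumr.
by apply: eq_bigr => j _; rewrite scalerA.
Qed.

Lemma smooth_row_mul_Gam U y z : open U -> smooth_row U y -> smooth_row U z ->
  smooth_row U (fun q => z q *m Gam (y q)).
Proof.
move=> oU sy sz k.
apply: (@smooth_fun_ext _ _ _ U oU
  (fun q => \sum_i y q 0 i * (\sum_j z q 0 j * G i j k))) => [q _|].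
  rewrite row_mul_Gam summxE; apply: eq_bigr => i _; rewrite summxE mulr_sumr.
  by apply: eq_bigr => j _; rewrite !mxE mulrA.
apply: smooth_fun_sum => // i; apply: smooth_funM => //.
apply: smooth_fun_sum => // j; apply: smooth_funM => //; exact: smooth_fun_cst.
Qed.

Lemma lie_row_mul_Gam U X y z p : open U -> smooth_row U y -> smooth_row U z ->
  U p -> lie_row X (fun q => z q *m Gam (y q)) p =
  lie_row X z p *m Gam (y p) + z p *m Gam (lie_row X y p).
Proof.
move=> oU sy sz Up; apply/rowP => k; rewrite !row_mul_Gam !mxE.
have sGz i : smooth_row U (fun q => z q *m G i) by exact: smooth_row_mulmx.
transitivity (lie_deriv X (fun q => \sum_i y q 0 i * (z q *m G i) 0 k) p).
  apply: (lie_deriv_eq oU) => // q _; rewrite row_mul_Gam summxE.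
  apply: eq_bigr => i _; rewrite summxE mxE mulr_sumr.
  by apply: eq_bigr => j _; rewrite !mxE mulrA.
rewrite (lie_deriv_sumM _ sy (fun i => sGz i k) Up) big_split/= addrC.
congr (_ + _); rewrite summxE; apply: eq_bigr => i _; rewrite summxE.
  have -> : lie_deriv X (fun q => (z q *m G i) 0 k) p = (lie_row X z p *m G i) 0 k.
    by rewrite -(lie_row_mulmx oU)// mxE.
  rewrite mxE mulr_sumr.
  by apply: eq_bigr => j _; rewrite [in RHS]mxE mulrA [row j (G i) 0 k]mxE.
rewrite mxE mulr_sumr.
by apply: eq_bigr => j _; rewrite !mxE mulrA.
Qed.

Lemma smooth_row_nabla U X Y : open U -> smooth_field U X -> smooth_field U Y ->
  smooth_row U (comp (nabla X Y)).
Proof.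
move=> oU sX sY k.
apply: (@smooth_fun_ext _ _ _ U oU (fun q => lie_row X (comp Y) q 0 k
    + (comp Y q *m Gam (comp X q)) 0 k)) => [q _|].
  by rewrite comp_nabla addmxE.
apply: smooth_funD => //.
  by apply: smooth_row_lie => //; exact: smooth_row_comp.
by apply: smooth_row_mul_Gam => //; exact: smooth_row_comp.
Qed.

Lemma smooth_nabla U X Y : open U -> smooth_field U X -> smooth_field U Y ->
  smooth_field U (nabla X Y).
Proof. by move=> oU sX sY; apply: smooth_of_comp => //; exact: smooth_row_nabla. Qed.

(* Matrices act on rows from the right, hence the order of the products. *)
Definition curv (x y : 'rV[R]_d) : 'M[R]_d :=
  Gam y *m Gam x - Gam x *m Gam y - Gam (br x y).

(** All derivatives of components cancel. Second derivatives of [Z] cancel by [lie_row_bracket],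
    mixed terms by symmetry, and derivatives of the components of [X] and [Y] against those in
    [comp_bracket]. Only products of constant matrices remain. *)
Lemma comp_curvature U X Y Z p : open U -> smooth_field U X -> smooth_field U Y ->
  smooth_field U Z -> U p ->
  comp (curvature nabla X Y Z) p = comp Z p *m curv (comp X p) (comp Y p).
Proof.
move=> oU sX sY sZ Up.
have sx := smooth_row_comp oU sX; have sy := smooth_row_comp oU sY.
have sz := smooth_row_comp oU sZ.
have second V W : smooth_field U V -> smooth_field U W ->
    comp (nabla V (nabla W Z)) p =
    lie_row V (lie_row W (comp Z)) p
    + (lie_row V (comp Z) p *m Gam (comp W p)
       + comp Z p *m Gam (lie_row V (comp W) p))
    + (lie_row W (comp Z) p + comp Z p *m Gam (comp W p)) *m Gam (comp V p).
  move=> sV sW; rewrite comp_nabla comp_nabla; congr (_ + _).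
  have sw := smooth_row_comp oU sW.
  rewrite -(@lie_row_mul_Gam U V (comp W) (comp Z) p oU sw sz Up).
  rewrite -(@lie_rowD U oU V _ _ p (smooth_row_lie oU sW sz)
    (smooth_row_mul_Gam oU sw sz) Up).
  by apply: (@lie_row_eq U oU) => // q _; exact: comp_nabla.
have -> : comp (curvature nabla X Y Z) p = comp (nabla X (nabla Y Z)) p
    - comp (nabla Y (nabla X Z)) p - comp (nabla (lie_bracket X Y) Z) p.
  by apply: etrans (mulmxBl _ _ _) _; congr (_ - _); exact: mulmxBl.
have GamE (u v w : 'rV[R]_d) : Gam (u - v + w) = Gam u - Gam v + Gam w.
  by rewrite linearD linearB.
rewrite (second X Y sX sY) (second Y X sY sX) (comp_nabla (lie_bracket X Y) Z p).
rewrite (@lie_row_bracket U oU X Y (comp Z) p sX sY sz Up).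
rewrite (comp_bracket oU sX sY Up) GamE /curv.
move: (Gam (br _ _)) (Gam (comp X p)) (Gam (comp Y p)) => K1 K4 K5.
move: (Gam (lie_row X (comp Y) p)) (Gam (lie_row Y (comp X) p)) => K2 K3.
move: (lie_row X (lie_row Y _) p) (lie_row Y (lie_row X _) p) => a1 a2.
move: (lie_row X (comp Z) p) (lie_row Y (comp Z) p) (comp Z p) => a3 a4 z.
rewrite !(mulmxDl, mulmxDr, mulmxN) !mulmxA.
(* With every product named, what remains is a linear identity between rows, which [ring] proves
   entry by entry. *)
move: (a3 *m _) (a4 *m _) (z *m K1) (z *m K2) (z *m K3) => b3 b4 b5 b6 b7.
move: (z *m K4 *m K5) (z *m K5 *m K4) => b8 b9.
by apply/rowP => k; rewrite !(addmxE, oppmxE); ring.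
Qed.

(** [C] is the constant matrix of the form in the frame; thus [bform 1%:M] is the metric that makes
    the frame orthonormal. [cform] is the analogue for covectors. *)
Definition bform (C : 'M[R]_d) : bilinear_field M := fun q =>
  invmx (frame_mx q) *m C *m (invmx (frame_mx q))^T.

Definition cform (a : 'cV[R]_d) : covector_field M := fun q =>
  invmx (frame_mx q) *m a.

Lemma ev1_cform a X q : ev1 (cform a) X q = (comp X q *m a) 0 0.
Proof. by rewrite /ev1 /cform mulmxA. Qed.

Lemma ev2_bform C X Y q :
  ev2 (bform C) X Y q = (comp X q *m C *m (comp Y q)^T) 0 0.
Proof. by rewrite /ev2 /bform /comp trmx_mul !mulmxA. Qed.

Lemma bform_wedge (a b : 'cV[R]_d) q :
  bform (wedge a b) q = wedge (cform a q) (cform b q).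
Proof. by rewrite /bform /cform /wedge mulmxBr mulmxBl !trmx_mul !mulmxA. Qed.

Lemma bformD (C C' : 'M[R]_d) q : bform (C + C') q = bform C q + bform C' q.
Proof. by rewrite /bform mulmxDr mulmxDl. Qed.

Lemma smooth_cform a : smooth_covector setT (cform a).
Proof.
move=> V X oV _ sX; apply: (@smooth_fun_ext _ _ _ V oV
  (fun q => \sum_i comp X q 0 i * a i 0)) => [q _|].
  by rewrite ev1_cform mxE.
apply: smooth_fun_sum => // i; apply: smooth_funM => //; last exact: smooth_fun_cst.
exact: smooth_comp.
Qed.

Lemma smooth_bform C : smooth_bilinear setT (bform C).
Proof.
move=> V X Y oV _ sX sY; apply: (@smooth_fun_ext _ _ _ V oV
  (fun q => ((comp X q *m C) *m (comp Y q)^T) 0 0)) => [q _|].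
  by rewrite ev2_bform.
apply: (smooth_fun_dot oV); last exact: smooth_row_comp.
by apply: smooth_row_mulmx => //; exact: smooth_row_comp.
Qed.

Lemma lie_deriv_ev1 U X Y a p : open U -> smooth_field U Y -> U p ->
  lie_deriv X (ev1 (cform a) Y) p = (lie_row X (comp Y) p *m a) 0 0.
Proof.
move=> oU sY Up; have sy := smooth_row_comp oU sY.
rewrite -(lie_deriv_mul_cst oU X a sy Up).
by apply: (lie_deriv_eq oU) => // q _; exact: ev1_cform.
Qed.

Lemma lie_deriv_ev2 U X Y Z C p : open U -> smooth_field U Y ->
  smooth_field U Z -> U p -> lie_deriv X (ev2 (bform C) Y Z) p =
  (lie_row X (comp Y) p *m C *m (comp Z p)^T) 0 0
  + (comp Y p *m C *m (lie_row X (comp Z) p)^T) 0 0.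
Proof.
move=> oU sY sZ Up; have sy := smooth_row_comp oU sY.
have sz := smooth_row_comp oU sZ.
have syC := smooth_row_mulmx oU C sy.
rewrite -addmxE -(lie_row_mulmx oU X C sy Up) -(lie_deriv_dot oU X syC sz Up).
by apply: (lie_deriv_eq oU) => // q _; exact: ev2_bform.
Qed.

Lemma br_mul (x y : 'rV[R]_d) n (C : 'M[R]_(d, n)) k :
  (br x y *m C) 0 k = \sum_i \sum_j x 0 i * y 0 j * (B i j *m C) 0 k.
Proof.
rewrite /br mulmx_suml summxE; apply: eq_bigr => i _.
rewrite mulmx_suml summxE; apply: eq_bigr => j _.
by rewrite -scalemxAl [LHS]mxE.
Qed.

(** Evaluating on two frame vectors isolates a single Christoffel row, which serves to refute
    parallelism. *)
Lemma parallel1_frame (a : 'cV[R]_d) (x0 : M) i j :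
  parallel1 (nabla) (cform a) -> (row j (G i) *m a) 0 0 = 0.
Proof.
move=> /(_ setT (E i) (E j) openT (smooth_frame i) (smooth_frame j) x0 I).
rewrite (lie_deriv_ev1 _ _ openT (smooth_frame j) I).
rewrite ev1_cform comp_nabla// mulmxDl addmxE opprD addrA subrr add0r.
by move=> /eqP; rewrite oppr_eq0 !comp_frame// Gam_delta -rowE => /eqP.
Qed.

(** The derivative terms of [ext_d1] cancel against those of [comp_bracket], leaving only the
    algebraic bracket. *)
Lemma closed1_cform a : (forall i j, B i j *m a = 0) -> closed1 (cform a).
Proof.
move=> Ba U X Y oU sX sY p Up; rewrite /ext_d1.
rewrite (lie_deriv_ev1 X a oU sY Up) (lie_deriv_ev1 Y a oU sX Up) ev1_cform.
rewrite (comp_bracket oU sX sY Up) !mulmxDl mulNmx.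
have -> : br (comp X p) (comp Y p) *m a = 0.
  apply/rowP => k; rewrite br_mul mxE big1// => i _; rewrite big1// => j _.
  by rewrite Ba [X in _ * X]mxE mulr0.
by rewrite addr0 addmxE oppmxE subrr.
Qed.

Lemma bform_swap (C : 'M[R]_d) (u v : 'rV[R]_d) : C^T = - C ->
  (u *m C *m v^T) 0 0 = - (v *m C *m u^T) 0 0.
Proof.
move=> CT; transitivity ((u *m C *m v^T)^T 0 0); first by rewrite [RHS]mxE.
by rewrite !trmx_mul trmxK CT mulNmx mulmxN oppmxE mulmxA.
Qed.

(** Once the derivative terms cancel, the Chevalley-Eilenberg differential of [C] remains; by
    trilinearity it suffices that it vanishes on frame vectors. *)
Lemma closed2_bform C : C^T = - C ->
  (forall i j k, (B i j *m C) 0 k - (B i k *m C) 0 j + (B j k *m C) 0 i = 0) ->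
  closed2 (bform C).
Proof.
move=> CT BC U X Y Z oU sX sY sZ p Up; rewrite /ext_d2.
rewrite (lie_deriv_ev2 X C oU sY sZ Up) (lie_deriv_ev2 Y C oU sX sZ Up).
rewrite (lie_deriv_ev2 Z C oU sX sY Up).
have cXY := comp_bracket oU sX sY Up; have cXZ := comp_bracket oU sX sZ Up.
have cYZ := comp_bracket oU sY sZ Up.
(* Only the components of the three brackets at [p] enter, so the brackets are replaced by arbitrary
   fields with these components. *)
suff H (bXY bXZ bYZ : vector_field M) :
    comp bXY p = lie_row X (comp Y) p - lie_row Y (comp X) p
      + br (comp X p) (comp Y p) ->
    comp bXZ p = lie_row X (comp Z) p - lie_row Z (comp X) p
      + br (comp X p) (comp Z p) ->
    comp bYZ p = lie_row Y (comp Z) p - lie_row Z (comp Y) p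
      + br (comp Y p) (comp Z p) ->
    (lie_row X (comp Y) p *m C *m (comp Z p)^T) 0 0 +
    (comp Y p *m C *m (lie_row X (comp Z) p)^T) 0 0 -
    ((lie_row Y (comp X) p *m C *m (comp Z p)^T) 0 0 +
     (comp X p *m C *m (lie_row Y (comp Z) p)^T) 0 0) +
    ((lie_row Z (comp X) p *m C *m (comp Y p)^T) 0 0 +
     (comp X p *m C *m (lie_row Z (comp Y) p)^T) 0 0) -
    ev2 (bform C) bXY Z p + ev2 (bform C) bXZ Y p - ev2 (bform C) bYZ X p = 0.
  exact: (H (lie_bracket X Y) (lie_bracket X Z) (lie_bracket Y Z)).
move=> {cXY cXZ cYZ} cXY cXZ cYZ.
rewrite (ev2_bform C bXY) (ev2_bform C bXZ) (ev2_bform C bYZ) cXY cXZ cYZ.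
move: (lie_row X (comp Y) p) (lie_row Y (comp X) p) (lie_row X (comp Z) p)
  (lie_row Z (comp X) p) (lie_row Y (comp Z) p) (lie_row Z (comp Y) p)
  (comp X p) (comp Y p) (comp Z p) => Xy Yx Xz Zx Yz Zy x y z.
pose w (u v : 'rV[R]_d) : R := (u *m C *m v^T) 0 0; rewrite -!/(w _ _).
have wD u u' v : w (u + u') v = w u v + w u' v by rewrite /w !mulmxDl addmxE.
have wN u v : w (- u) v = - w u v by rewrite /w !mulNmx oppmxE.
have wS u v : w u v = - w v u by exact: bform_swap.
rewrite !wD !wN.
have wbr : w (br x y) z - w (br x z) y + w (br y z) x = 0.
  have br3 (u v t : 'rV[R]_d) : w (br u v) t =
      \sum_i \sum_j \sum_k u 0 i * v 0 j * t 0 k * (B i j *m C) 0 k.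
    rewrite /w mxE; under eq_bigr => k _ do rewrite br_mul mulr_suml.
    rewrite exchange_big/=; apply: eq_bigr => i _.
    under eq_bigr => k _ do rewrite mulr_suml.
    rewrite exchange_big/=; apply: eq_bigr => j _; apply: eq_bigr => k _.
    by rewrite [t^T k 0]mxE mulrAC.
  have -> : w (br x z) y =
      \sum_i \sum_j \sum_k x 0 i * y 0 j * z 0 k * (B i k *m C) 0 j.
    rewrite br3; apply: eq_bigr => i _; rewrite exchange_big/=.
    by apply: eq_bigr => j _; apply: eq_bigr => k _; rewrite (mulrAC (x 0 i)).
  have -> : w (br y z) x =
      \sum_i \sum_j \sum_k x 0 i * y 0 j * z 0 k * (B j k *m C) 0 i.
    have rot (F : 'I_d -> 'I_d -> 'I_d -> R) :
        \sum_j \sum_k \sum_i F i j k = \sum_i \sum_j \sum_k F i j k.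
      by under eq_bigr => j _ do rewrite exchange_big/=; exact: exchange_big.
    rewrite br3 -[RHS]rot; apply: eq_bigr => i _; apply: eq_bigr => j _.
    by apply: eq_bigr => k _; ring.
  rewrite br3 -sumrB -big_split/= big1// => i _.
  rewrite -sumrB -big_split/= big1// => j _.
  rewrite -sumrB -big_split/= big1// => k _.
  by rewrite -mulrBr -mulrDr BC mulr0.
move: wbr; move: (w (br x y) z) (w (br x z) y) (w (br y z) x) => b1 b2 b3 b123.
(* Skewness puts each derivative term in the order in which it occurs with the opposite sign. *)
rewrite (wS y Xz) (wS x Yz) (wS x Zy).
by apply: etrans (_ : _ = - (b1 - b2 + b3)) _; [ring|rewrite b123 oppr0].
Qed.

(** * The Levi-Civita connection of an orthonormal frame *)

Section LeviCivita.
Hypothesis skew : forall i, (G i)^T = - G i.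
Hypothesis torsion : forall i j, row j (G i) - row i (G j) = B i j.

Lemma Gam_skew (x : 'rV[R]_d) : (Gam x)^T = - Gam x.
Proof.
rewrite /Gam raddf_sum -sumrN; apply: eq_bigr => i _ /=.
by rewrite linearZ/= skew scalerN.
Qed.

Lemma Gam_torsion (x y : 'rV[R]_d) : y *m Gam x - x *m Gam y = br x y.
Proof.
rewrite !row_mul_Gam [X in _ - X]exchange_big/= -sumrB; apply: eq_bigr => i _.
rewrite -sumrB; apply: eq_bigr => j _.
by rewrite (mulrC (y 0 j)) -scalerBr torsion.
Qed.

Lemma comp_add X Y q : comp (X + Y) q = comp X q + comp Y q.
Proof. exact: mulmxDl. Qed.

Lemma comp_scale (F : M -> R) X q : comp (fun r => F r *: X r) q = F q *: comp X q.
Proof. exact/esym/scalemxAl. Qed.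

Lemma lie_row_comp_frame (X : vector_field M) (y : M -> 'rV[R]_d) U p :
  smooth_row U y -> U p ->
  lie_row X y p = \sum_i comp X p 0 i *: lie_row (E i) y p.
Proof.
by move=> sy Up; exact: lie_row_sum sy Up (frame_sum X p).
Qed.

(** Torsion-freeness is [Gam_torsion] together with the derivative terms of [comp_bracket].
    Compatibility is skewness of [Gam], since the metric has the identity matrix in the frame.
    Tensoriality in the first argument reduces to derivation along frame vectors. *)
Lemma nabla_levi_civita : is_levi_civita (bform 1%:M) nabla.
Proof.
split.
- exact: smooth_nabla.
- move=> U X X' Y p oU sX sX' sY Up; rewrite /nabla -mulmxDl; congr (_ *m _).
  have sy := smooth_row_comp oU sY.
  rewrite !(lie_row_comp_frame _ sy Up) comp_add linearD mulmxDr addrACA.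
  congr (_ + _); rewrite -big_split; apply: eq_bigr => i _.
  by rewrite addmxE scalerDl.
- move=> U F X Y p oU sF sX sY Up; rewrite /nabla scalemxAl; congr (_ *m _).
  have sy := smooth_row_comp oU sY.
  rewrite !(lie_row_comp_frame _ sy Up) comp_scale linearZ -scalemxAr scalerDr.
  congr (_ + _); rewrite scaler_sumr; apply: eq_bigr => i _.
  by rewrite scalerA scalemxE.
- move=> U X Y Y' p oU sX sY sY' Up; rewrite /nabla -mulmxDl; congr (_ *m _).
  have sy := smooth_row_comp oU sY; have sy' := smooth_row_comp oU sY'.
  rewrite comp_add mulmxDl addrACA -(lie_rowD oU X sy sy' Up); congr (_ + _).
  by apply: (lie_row_eq oU) => // q _; exact: comp_add.
- move=> U F X Y p oU sF sX sY Up; rewrite /nabla.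
  have sy := smooth_row_comp oU sY.
  have -> : lie_deriv X F p *: Y p = (lie_deriv X F p *: comp Y p) *m frame_mx p.
    by rewrite -scalemxAl compK.
  rewrite (scalemxAl (F p)) -mulmxDl; congr (_ *m _).
  rewrite comp_scale -scalemxAl scalerDr addrA; congr (_ + _).
  rewrite -(lie_rowZ oU X sF sy Up).
  by apply: (lie_row_eq oU) => // q _; exact: comp_scale.
- move=> U X Y p oU sX sY Up.
  rewrite /nabla -mulmxBl -(compK (lie_bracket X Y) p); congr (_ *m _).
  by rewrite (comp_bracket oU sX sY Up) -Gam_torsion opprD addrACA.
- move=> U X Y Z p oU sX sY sZ Up.
  rewrite (lie_deriv_ev2 X 1%:M oU sY sZ Up).
  rewrite (ev2_bform 1%:M (nabla X Y)) (ev2_bform 1%:M Y).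
  rewrite (comp_nabla X Y) (comp_nabla X Z) !mulmx1.
  move: (lie_row X (comp Y) p) (lie_row X (comp Z) p) (comp X p) (comp Y p) (comp Z p)
    => Xy Xz x y z.
  rewrite linearD/= mulmxDl mulmxDr trmx_mul Gam_skew mulNmx mulmxN mulmxA.
  by rewrite !addmxE oppmxE; ring.
Qed.

Lemma invmx_bform1 q : invmx (bform 1%:M q) = (frame_mx q)^T *m frame_mx q.
Proof.
have gK : bform 1%:M q *m ((frame_mx q)^T *m frame_mx q) = 1%:M.
  rewrite /bform mulmx1 trmx_inv mulmxA mulmxKV ?unitmx_tr//.
  by rewrite mulVmx.
have gu : bform 1%:M q \in unitmx by case: (mulmx1_unit gK).
by rewrite -[RHS](mulKmx gu) gK mulmx1.
Qed.

Lemma coframe_orthonormal p (i j : 'I_d) :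
  ((cform (delta_mx i 0) p)^T *m invmx (bform 1%:M p)
     *m cform (delta_mx j 0) p) 0 0 = (i == j)%:R.
Proof.
have PK := mulmxV (frame_mx_unit p).
rewrite invmx_bform1// /cform trmx_mul trmx_delta -!mulmxA.
rewrite (mulmxA (frame_mx p)) PK mul1mx.
rewrite (mulmxA (invmx _)^T) -trmx_mul PK trmx1 mul1mx.
by rewrite mul_delta_mx_cond mulmxnE mxE !eqxx.
Qed.

Lemma bform1_riemannian : riemannian_metric (bform 1%:M).
Proof.
split; first exact: smooth_bform.
- by move=> p; rewrite /bform mulmx1 trmx_mul trmxK.
move=> p v v0; rewrite /bform mulmx1 !mulmxA -mulmxA -trmx_mul mxE.
have w0 : v *m invmx (frame_mx p) != 0.
  apply: contra v0 => /eqP w0.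
  by rewrite -(mulmxKV (frame_mx_unit p) v) w0 mul0mx.
have sq i : 0 <= (v *m invmx (frame_mx p)) 0 i * (v *m invmx (frame_mx p))^T i 0.
  by rewrite [_^T _ _]mxE -expr2 sqr_ge0.
rewrite lt_def sumr_ge0 ?andbT//; apply: contra w0 => /eqP s0.
apply/eqP/rowP => i; rewrite [RHS]mxE.
have /eqP := s0; rewrite psumr_eq0// => /allP /(_ i (mem_index_enum _)).
by rewrite [_^T _ _]mxE -expr2 sqrf_eq0 => /eqP.
Qed.

Definition curv0 a b : 'M[R]_d := G b *m G a - G a *m G b - Gam (B a b).

Lemma curvE (x y : 'rV[R]_d) :
  curv x y = \sum_a \sum_b (x 0 a * y 0 b) *: curv0 a b.
Proof.
have prodE (u v : 'rV[R]_d) :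
    Gam u *m Gam v = \sum_a \sum_b (u 0 a * v 0 b) *: (G a *m G b).
  rewrite /Gam mulmx_suml; apply: eq_bigr => a _.
  rewrite mulmx_sumr; apply: eq_bigr => b _.
  by rewrite -scalemxAl -scalemxAr scalerA.
have brE : Gam (br x y) = \sum_a \sum_b (x 0 a * y 0 b) *: Gam (B a b).
  rewrite /br linear_sum; apply: eq_bigr => a _ /=.
  by rewrite linear_sum; apply: eq_bigr => b _ /=; rewrite linearZ.
rewrite /curv !prodE brE exchange_big/= -!sumrB; apply: eq_bigr => a _.
rewrite -!sumrB; apply: eq_bigr => b _.
by rewrite (mulrC (y 0 b)) -!scalerBr.
Qed.

(** * Traces in an arbitrary orthonormal frame *)

Section OrthonormalFrame.
Variables (U : set M) (f : 'I_d -> vector_field M) (p : M).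
Hypotheses (oU : open U) (f_orth : orthonormal_frame (bform 1%:M) U f) (Up : U p).

Let Q : 'M[R]_d := \matrix_(i, k) comp (f i) p 0 k.

Let row_Q i : row i Q = comp (f i) p.
Proof. by apply/rowP => k; rewrite !mxE. Qed.

Lemma orthonormal_mx : Q *m Q^T = 1%:M.
Proof.
apply/matrixP => i j; have := f_orth.2 p i j Up; rewrite ev2_bform mulmx1 => fij.
rewrite [RHS]mxE -fij mxE [RHS]mxE; apply: eq_bigr => k _.
by rewrite ![_^T _ _]mxE -!row_Q ![row _ _ _ _]mxE.
Qed.

(** The components of [f] form an orthogonal matrix [Q]. From [Q *m Q^T = 1] follows [Q^T *m Q = 1],
    so a trace taken in [f] equals the trace taken in [E]. *)
Lemma orthonormal_trace (H : 'I_d -> 'I_d -> R) :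
  \sum_i \sum_a \sum_b comp (f i) p 0 a * comp (f i) p 0 b * H a b = \sum_a H a a.
Proof.
have QQ a b : \sum_i comp (f i) p 0 a * comp (f i) p 0 b = (a == b)%:R.
  have := mulmx1C orthonormal_mx => /matrixP /(_ a b); rewrite !mxE => <-.
  apply: eq_bigr => i _.
  by rewrite ![_^T _ _]mxE -!row_Q ![row _ _ _ _]mxE.
rewrite exchange_big/=; apply: eq_bigr => a _.
transitivity (\sum_b (a == b)%:R * H a b).
  rewrite exchange_big/=; apply: eq_bigr => b _.
  by rewrite -QQ mulr_suml.
rewrite (bigD1 a)//= eqxx mul1r big1 ?addr0// => b ba.
by rewrite eq_sym (negbTE ba) mul0r.
Qed.

Lemma ricci_nabla Y Z : smooth_field U Y -> smooth_field U Z ->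
  ricci (bform 1%:M) nabla f Y Z p =
  \sum_b \sum_c comp Y p 0 b * comp Z p 0 c * \sum_a curv0 a b c a.
Proof.
move=> sY sZ; rewrite /ricci.
pose N a : 'M[R]_d := \sum_b comp Y p 0 b *: curv0 a b.
have curvN (x : 'rV[R]_d) : curv x (comp Y p) = \sum_a x 0 a *: N a.
  rewrite curvE; apply: eq_bigr => a _; rewrite scaler_sumr.
  by apply: eq_bigr => b _; rewrite scalerA.
transitivity (\sum_i \sum_a \sum_e comp (f i) p 0 a * comp (f i) p 0 e
    * (comp Z p *m N a) 0 e).
  apply: eq_bigr => i _; have si := f_orth.1 i.
  rewrite ev2_bform mulmx1 (comp_curvature oU si sY sZ Up) curvN.
  rewrite mulmx_sumr mulmx_suml summxE; apply: eq_bigr => a _.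
  rewrite -scalemxAr -scalemxAl scalemxE [X in _ * X]mxE mulr_sumr.
  apply: eq_bigr => e _.
  by rewrite [_^T _ _]mxE; ring.
rewrite orthonormal_trace.
transitivity (\sum_a \sum_b \sum_c comp Y p 0 b * comp Z p 0 c * curv0 a b c a).
  apply: eq_bigr => a _; rewrite [RHS]exchange_big/= [LHS]mxE; apply: eq_bigr => c _.
  rewrite /N summxE mulr_sumr; apply: eq_bigr => b _.
  by rewrite scalemxE; ring.
rewrite exchange_big/=; apply: eq_bigr => b _; rewrite exchange_big/=.
by apply: eq_bigr => c _; rewrite mulr_sumr.
Qed.

(** The metric is the identity in the frame, so raising an index leaves the matrix of the form
    unchanged. *)
Lemma comp_J_field W X q : comp (J_field (bform W) (bform 1%:M) X) q = comp X q *m W.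
Proof.
have PK := mulmxV (frame_mx_unit q).
rewrite /comp /J_field invmx_bform1 /bform -!mulmxA PK mulmx1.
by rewrite -trmx_mul PK trmx1 mulmx1.
Qed.

(** The matrix of the star-Ricci form in the frame [E]: right multiplication by [W] is the
    endomorphism [J], and [curv0 a b] is the curvature on the frame vectors [a] and [b]. *)
Definition star_mx (W : 'M[R]_d) : 'M[R]_d :=
  \matrix_(a, c) \sum_b (W *m curv0 a b) b c.

Lemma star_ricci_nabla W X Y : smooth_field U X ->
  star_ricci (bform W) (bform 1%:M) nabla f X Y p =
  (comp X p *m star_mx W *m (comp Y p)^T) 0 0.
Proof.
move=> sX; rewrite /star_ricci.
pose N b : 'M[R]_d := \sum_a comp X p 0 a *: curv0 a b.
have curvN (x : 'rV[R]_d) : curv (comp X p) x = \sum_b x 0 b *: N b.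
  rewrite curvE exchange_big/=; apply: eq_bigr => b _; rewrite scaler_sumr.
  by apply: eq_bigr => a _; rewrite scalerA mulrC.
have sJ i : smooth_field U (J_field (bform W) (bform 1%:M) (f i)).
  apply: smooth_of_comp => // k.
  apply: (@smooth_fun_ext _ _ _ U oU (fun q => (comp (f i) q *m W) 0 k)) => [q _|].
    by rewrite comp_J_field.
  apply: (smooth_row_mulmx oU); apply: smooth_row_comp => //.
  exact: f_orth.1.
transitivity (\sum_i \sum_e \sum_b comp (f i) p 0 e * comp (f i) p 0 b
    * (W *m N b *m (comp Y p)^T) e 0).
  apply: eq_bigr => i _; have si := f_orth.1 i.
  rewrite ev2_bform mulmx1 (comp_curvature oU sX si (sJ i) Up) comp_J_field curvN.
  rewrite mulmx_sumr mulmx_suml summxE exchange_big/=; apply: eq_bigr => b _.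
  rewrite -scalemxAr -scalemxAl scalemxE -!(mulmxA (comp (f i) p)).
  rewrite [X in _ * X]mxE mulr_sumr.
  apply: eq_bigr => e _.
  by ring.
rewrite orthonormal_trace.
transitivity (\sum_b \sum_a \sum_c comp X p 0 a * comp Y p 0 c * (W *m curv0 a b) b c).
  apply: eq_bigr => b _; rewrite [LHS]mxE [RHS]exchange_big/=; apply: eq_bigr => c _.
  rewrite /N mulmx_sumr summxE mulr_suml; apply: eq_bigr => a _.
  by rewrite -scalemxAr scalemxE [_^T _ _]mxE; ring.
rewrite exchange_big/= [RHS]mxE.
under [RHS]eq_bigr => c _ do rewrite [X in X * _]mxE mulr_suml.
rewrite [RHS]exchange_big/=; apply: eq_bigr => a _; rewrite exchange_big/=.
apply: eq_bigr => c _; rewrite [star_mx W a c]mxE [_^T _ _]mxE -mulr_sumr.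
by rewrite mulrAC.
Qed.

Lemma sum_ltn_swap (h : 'I_d -> 'I_d -> R) : (forall i j, h i j = h j i) ->
  (forall i, h i i = 0) ->
  \sum_i \sum_j h i j = 2 * \sum_(i < d) \sum_(j < d | (i < j)%N) h i j.
Proof.
move=> hC h0; have lt_gt : \sum_(i < d) \sum_(j < d | (j < i)%N) h i j =
    \sum_(i < d) \sum_(j < d | (i < j)%N) h i j.
  rewrite (exchange_big_dep predT)//=; apply: eq_bigr => i _; apply: eq_bigr => j _.
  exact: hC.
rewrite mulr_natl mulr2n -{1}lt_gt -big_split/=; apply: eq_bigr => i _.
rewrite (bigID (fun j : 'I_d => (j < i)%N))/=; congr (_ + _).
rewrite (bigD1 i)/= ?ltnn// h0 add0r; apply: eq_bigl => j.
by rewrite -leqNgt ltn_neqAle eq_sym andbC.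
Qed.

(** For skew matrices the product of entries is symmetric and vanishes on the diagonal, so the sum
    over all pairs is twice the sum over [i < j]. The full sum is a trace, which conjugation by the
    orthogonal matrix [Q] preserves. *)
Lemma inner2_star W : W^T = - W -> (star_mx W)^T = - star_mx W ->
  2 * inner2 f (ev2 (bform W)) (star_ricci (bform W) (bform 1%:M) nabla f) p =
  \tr (W *m (star_mx W)^T).
Proof.
move=> WT ST; set S := star_mx W in ST *.
pose w (C : 'M[R]_d) i j := (comp (f i) p *m C *m (comp (f j) p)^T) 0 0.
have innerE : inner2 f (ev2 (bform W)) (star_ricci (bform W) (bform 1%:M) nabla f) p =
    \sum_(i < d) \sum_(j < d | (i < j)%N) w W i j * w S i j.
  apply: eq_bigr => i _; apply: eq_bigr => j _; congr (_ * _).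
    exact: ev2_bform.
  exact: star_ricci_nabla (f_orth.1 i).
have wS C i j : C^T = - C -> w C i j = - w C j i by exact: bform_swap.
have w0 C i : C^T = - C -> w C i i = 0.
  by move=> /wS -/(_ i i) => /eqP; rewrite -addr_eq0 -mulr2n mulrn_eq0/= => /eqP.
rewrite innerE -(@sum_ltn_swap (fun i j => w W i j * w S i j)); last 2 first.
- by move=> i j; rewrite (wS W i j WT) (wS S i j ST) mulrNN.
- by move=> i; rewrite (w0 W i WT) mul0r.
have wE C i j : w C i j = (Q *m C *m Q^T) i j.
  rewrite /w -!row_Q -row_mul mxE [RHS]mxE; apply: eq_bigr => k _.
  by rewrite [row _ _ _ _]mxE ![_^T _ _]mxE [row _ _ _ _]mxE.
transitivity (\tr ((Q *m W *m Q^T) *m (Q *m S *m Q^T)^T)).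
  rewrite /mxtrace; apply: eq_bigr => i _; rewrite mxE; apply: eq_bigr => j _.
  by rewrite [_^T _ _]mxE !wE.
rewrite !trmx_mul trmxK -!mulmxA mxtrace_mulC -!mulmxA (mulmx1C orthonormal_mx).
rewrite mulmx1 (mulmxA Q^T) (mulmx1C orthonormal_mx) mul1mx.
by [].
Qed.

End OrthonormalFrame.

Lemma nabla_einstein tau :
  (forall b c, \sum_a curv0 a b c a = (b == c)%:R * tau) ->
  einstein (bform 1%:M) nabla tau.
Proof.
move=> ric U f Y Z oU f_orth sY sZ p Up.
rewrite (ricci_nabla oU f_orth Up sY sZ) ev2_bform mulmx1 mxE mulr_sumr.
apply: eq_bigr => b _; rewrite (bigD1 b)//= ric eqxx mul1r big1 => [|c cb].
  by rewrite addr0 [_^T _ _]mxE mulrC.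
by rewrite ric eq_sym (negbTE cb) mul0r mulr0.
Qed.

End LeviCivita.

End Connection.
End Bracket.

End Frame.

(** * Structure constants and curvature of the Lie algebra *)

Ltac ord5 i := case: i => [[|[|[|[|[|//]]]]] ?].

Section Table.
Context {R : realType}.

Let s : R := Num.sqrt 3 / 2.

(* The coefficient at (e_(i+1), e_(j+1)) of the 2-form e^(a+1) /\ e^(b+1): all
   indices in the tables start at 0. *)
Definition e2 (a b i j : nat) : R :=
  ((i == a) && (j == b))%:R - ((i == b) && (j == a))%:R.

(** The signs come from the convention that [e([x, y])] is minus [de(x, y)]. *)
Definition struct_cst (i j k : nat) : R :=
  match k with
  | 0 => - (s * e2 1 4 i j + 2^-1 * e2 0 3 i j)
  | 1 => - (s * e2 0 4 i j + 2^-1 * e2 1 3 i j)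
  | 2 => - (e2 0 1 i j + e2 2 3 i j)
  | _ => 0
  end.

(* Koszul: the component [k] of the derivative of the frame vector [j] along the
   frame vector [i] is half of c_ijk - c_jki + c_kij, where c is [struct_cst]. *)
Definition christoffel (i j k : nat) : R :=
  match i, j, k with
  | 0, 0, 3 | 0, 2, 1 | 1, 0, 2 | 1, 1, 3 | 2, 0, 1 => 2^-1
  | 0, 3, 0 | 0, 1, 2 | 1, 2, 0 | 1, 3, 1 | 2, 1, 0 => - 2^-1
  | 0, 1, 4 | 1, 0, 4 => s
  | 0, 4, 1 | 1, 4, 0 => - s
  | 2, 2, 3 => 1
  | 2, 3, 2 => - 1
  | _, _, _ => 0
  end.

(** The curvature entries are polynomials in [s]; this value of [s * s] makes their identities
    linear. *)
Lemma sqr_s : s * s = 3 / 4.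
Proof.
rewrite /s mulrACA -expr2 sqr_sqrtr ?ler0n//; lra.
Qed.

(** Tables and sums over natural numbers reduce by computation, unlike big sums of matrix entries
    over ['I_5]. *)
Definition sum5 (F : nat -> R) : R := F 0%N + F 1%N + F 2%N + F 3%N + F 4%N.

Lemma sum_ord5 (F : nat -> R) : \sum_(i < 5) F i = sum5 F.
Proof. by rewrite !big_ord_recr big_ord0/= add0r. Qed.

Definition curv_cst (a b k l : nat) : R :=
  sum5 (fun m => christoffel b k m * christoffel a m l)
  - sum5 (fun m => christoffel a k m * christoffel b m l)
  - sum5 (fun m => struct_cst a b m * christoffel m k l).

Lemma christoffel_skew (i j k : 'I_5) : christoffel i j k = - christoffel i k j.
Proof. by ord5 i; ord5 j; ord5 k; rewrite /= ?oppr0 ?opprK. Qed.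

Lemma christoffel_torsion (i j k : 'I_5) :
  christoffel i j k - christoffel j i k = struct_cst i j k.
Proof.
by ord5 i; ord5 j; ord5 k; rewrite /struct_cst /e2 /christoffel /=; lra.
Qed.

Definition w_cst (i j : nat) : R := e2 0 1 i j + e2 2 3 i j.

Lemma w_closed (i j k : 'I_5) :
  sum5 (fun m => struct_cst i j m * w_cst m k)
  - sum5 (fun m => struct_cst i k m * w_cst m j)
  + sum5 (fun m => struct_cst j k m * w_cst m i) = 0.
Proof.
by ord5 i; ord5 j; ord5 k; rewrite /sum5 /w_cst /struct_cst /e2 /=; lra.
Qed.

(** The star-Ricci form is not a multiple of omega: its coefficients on [e^12] and [e^34] differ,
    and their sum [- 9 / 4] is its inner product with omega. *)
Lemma star_cst (a c : 'I_5) :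
  sum5 (fun b => sum5 (fun m => w_cst b m * curv_cst a b m c))
  = - (3 / 4) * e2 0 1 a c - 3 / 2 * e2 2 3 a c.
Proof.
have ss := sqr_s.
by ord5 a; ord5 c => /=;
  rewrite /curv_cst /sum5 /w_cst /struct_cst /e2 /christoffel /=; lra.
Qed.

Lemma ricci_cst (b c : 'I_5) :
  sum5 (fun a => curv_cst a b c a) = (b == c)%:R * (- (3 / 2)).
Proof.
have ss := sqr_s.
by rewrite -val_eqE; ord5 b; ord5 c => /=;
  rewrite /curv_cst /sum5 /struct_cst /e2 /christoffel /=; lra.
Qed.

Definition struct_row (i j : 'I_5) : 'rV[R]_5 := \row_k struct_cst i j k.
Definition christoffel_mx (i : 'I_5) : 'M[R]_5 := \matrix_(j, k) christoffel i j k.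

Lemma cov2E (a b : nat) (i j : 'I_5) : (a < 5)%N -> (b < 5)%N ->
  cov2 R a.+1 b.+1 i j = e2 a b i j.
Proof.
move=> a5 b5; rewrite /cov2 /wedge /cov /= !mxE !big_ord_recl !big_ord0 !mxE/=.
by rewrite !addr0 !andbT -!val_eqE /= !inordK// /e2 -!natrM !mulnb.
Qed.

Lemma de_cst (i j k : 'I_5) : - de R k i j = struct_cst i j k.
Proof.
ord5 k; rewrite /de/= /struct_cst 1?addmxE ?scalemxE; first 3 last.
1,2: by rewrite mxE oppr0.
all: by rewrite !cov2E.
Qed.

Lemma g_bracketE (x y : 'rV[R]_5) k :
  g_bracket x y 0 k = \sum_i \sum_j x 0 i * y 0 j * struct_cst i j k.
Proof.
rewrite [LHS]mxE -mulmxA mxE -sumrN; apply: eq_bigr => i _.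
rewrite mxE mulr_sumr -sumrN; apply: eq_bigr => j _.
by rewrite -de_cst [_^T _ _]mxE; ring.
Qed.

Lemma g_bracket_delta (i j : 'I_5) :
  g_bracket (delta_mx 0 i) (delta_mx 0 j) = struct_row i j.
Proof.
apply/rowP => k; rewrite [LHS]mxE [RHS]mxE trmx_delta -rowE -colE.
by rewrite [col _ _ _ _]mxE [row _ _ _ _]mxE de_cst.
Qed.

Definition omega_mx : 'M[R]_5 := cov2 R 1 2 + cov2 R 3 4.

Lemma omega_mxE (i j : 'I_5) : omega_mx i j = w_cst i j.
Proof. by rewrite addmxE !cov2E. Qed.

Lemma christoffel_mx_skew i : (christoffel_mx i)^T = - christoffel_mx i.
Proof. by apply/matrixP => j k; rewrite !mxE christoffel_skew. Qed.

Lemma christoffel_mx_torsion i j :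
  row j (christoffel_mx i) - row i (christoffel_mx j) = struct_row i j.
Proof. by apply/rowP => k; rewrite !mxE christoffel_torsion. Qed.

Lemma struct_row_omega i j k :
  (struct_row i j *m omega_mx) 0 k = sum5 (fun m => struct_cst i j m * w_cst m k).
Proof.
by rewrite mxE -sum_ord5; apply: eq_bigr => m _; rewrite mxE omega_mxE.
Qed.

Lemma omega_mx_skew : omega_mx^T = - omega_mx.
Proof.
apply/matrixP => i j; rewrite oppmxE [LHS]mxE !omega_mxE /w_cst /e2.
by ord5 i; ord5 j => /=; lra.
Qed.

Lemma curv0_cst a b k l :
  curv0 struct_row christoffel_mx a b k l = curv_cst a b k l.
Proof.
rewrite /curv0 !(addmxE, oppmxE) /Gam summxE /curv_cst -!sum_ord5.
congr (_ - _ - _); rewrite ?mxE; apply: eq_bigr => m _.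
- by rewrite !mxE.
- by rewrite !mxE.
- by rewrite scalemxE !mxE.
Qed.

Lemma star_mx_cst a c : star_mx struct_row christoffel_mx omega_mx a c =
  - (3 / 4) * e2 0 1 a c - 3 / 2 * e2 2 3 a c.
Proof.
rewrite -star_cst mxE -sum_ord5; apply: eq_bigr => b _.
rewrite mxE -sum_ord5; apply: eq_bigr => m _.
by rewrite omega_mxE curv0_cst.
Qed.

Lemma star_mx_skew : (star_mx struct_row christoffel_mx omega_mx)^T =
  - star_mx struct_row christoffel_mx omega_mx.
Proof.
apply/matrixP => i j; rewrite [LHS]mxE oppmxE !star_mx_cst /e2.
by ord5 i; ord5 j => /=; lra.
Qed.

(** The trace counts each pair of indices in both orders, hence twice [- (3 / 4) - 3 / 2]. *)
Lemma star_mx_trace :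
  \tr (omega_mx *m (star_mx struct_row christoffel_mx omega_mx)^T) = - (9 / 2).
Proof.
transitivity (sum5 (fun i => sum5 (fun j =>
    w_cst i j * (- (3 / 4) * e2 0 1 i j - 3 / 2 * e2 2 3 i j)))).
  rewrite /mxtrace -sum_ord5; apply: eq_bigr => i _.
  rewrite mxE -sum_ord5; apply: eq_bigr => j _.
  by rewrite [_^T _ _]mxE omega_mxE star_mx_cst.
by rewrite /sum5 /w_cst /e2 /=; lra.
Qed.

End Table.

(** * Left-invariant frames and solvability *)

Section LieGroup.
Context {R : realType} {d : nat} (G : lieGroup R d).
Implicit Types p q : G.

Lemma lg_mulVr p : lg_mul p (lg_inv p) = lg_one G.
Proof.
rewrite -[LHS]lg_mul1 -{1}(lg_mulV (lg_inv p)) -lg_mulA (lg_mulA (lg_inv p) p).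
by rewrite lg_mulV lg_mul1 lg_mulV.
Qed.

Lemma lg_mulr1 p : lg_mul p (lg_one G) = p.
Proof. by rewrite -(lg_mulV p) lg_mulA lg_mulVr lg_mul1. Qed.

(** Left translation by [q] times the inverse of [p] carries [p] to [q], and a derivative in the
    direction 0 vanishes. *)
Lemma left_invariant_eq0 (X : vector_field G) p :
  left_invariant X -> X p = 0 -> X = 0.
Proof.
move=> linv Xp; apply/funext => q.
have <- : lg_mul (lg_mul q (lg_inv p)) p = q by rewrite -lg_mulA lg_mulV lg_mulr1.
by rewrite linv Xp /tangent_map derive0.
Qed.

Context {m : nat} (L : {linear 'rV[R]_m -> vector_field G}).

Lemma linear_delta (v : 'rV[R]_m) p :
  L v p = \sum_i v 0 i *: L (delta_mx 0 i) p.
Proof.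
rewrite {1}(row_sum_delta v) linear_sum fct_sumE; apply: eq_bigr => i _.
by rewrite linearZ.
Qed.

End LieGroup.

Section LeftInvariantFrame.
Context {R : realType} {d : nat} (G : lieGroup R d).
Variable L : {linear 'rV[R]_d -> vector_field G}.
Hypotheses (L_inj : injective L) (L_lie : range L = lie_algebra G).

Definition left_frame (i : 'I_d) : vector_field G := L (delta_mx 0 i).

Lemma left_frame_lie x : lie_algebra G (L x).
Proof. by rewrite -L_lie; exists x. Qed.

Lemma smooth_left_frame i : smooth_field setT (left_frame i).
Proof. by have [] := left_frame_lie (delta_mx 0 i). Qed.

Lemma mul_left_frame v p : v *m frame_mx left_frame p = L v p.
Proof.
rewrite linear_delta mulmx_sum_row; apply: eq_bigr => i _; congr (_ *: _).
by apply/rowP => k; rewrite !mxE.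
Qed.

(** Injectivity of [L] says that the frame vectors are independent as fields; left invariance makes
    them independent at each point, since a combination vanishing at [p] vanishes everywhere. *)
Lemma left_frame_unit p : frame_mx left_frame p \in unitmx.
Proof.
rewrite -row_free_unit; apply: inj_row_free => v; rewrite mul_left_frame => Lv0.
apply: L_inj; rewrite linear0; apply: left_invariant_eq0 Lv0.
by have [] := left_frame_lie v.
Qed.

End LeftInvariantFrame.

(** * The derived series *)

Section Solvable.
Context {R : realType} (G : lieGroup R 5).
Variable L : {linear 'rV[R]_5 -> vector_field G}.
Hypothesis L_bracket : forall x y, L (g_bracket x y) = lie_bracket (L x) (L y).

Definition support_in (A : pred nat) : set 'rV[R]_5 :=
  [set x | forall i : 'I_5, x 0 i != 0 -> A i].

(** Bounding each derived algebra by a coordinate subspace leaves only the positions of the nonzero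
    structure constants to be checked. *)
Lemma derived_support (A A' : pred nat) S :
  (forall i j k : 'I_5, A i -> A j -> struct_cst (R := R) i j k != 0 -> A' k) ->
  S `<=` L @` support_in A ->
  derived_set (@lie_bracket R 5 G) S `<=` L @` support_in A'.
Proof.
move=> AA' SA z; apply.
- exists 0; last by rewrite linear0.
  by move=> i; rewrite mxE eqxx.
- move=> c _ _ [x Ax <-] [y Ay <-]; exists (c *: x + y); last by rewrite linearP.
  move=> i; apply: contraNT => Ai; rewrite !mxE.
  have [/eqP -> /eqP ->] : x 0 i == 0 /\ y 0 i == 0.
    by split; apply: contraNT Ai; [exact: Ax|exact: Ay].
  by rewrite mulr0 addr0.
move=> _ _ /SA[x Ax <-] /SA[y Ay <-]; exists (g_bracket x y) => // k.
apply: contraNT => Ak; rewrite g_bracketE big1// => i _; rewrite big1// => j _.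
have [->|xi] := eqVneq (x 0 i) 0; first by rewrite mul0r mul0r.
have [->|yj] := eqVneq (y 0 j) 0; first by rewrite mulr0 mul0r.
have [->|cst0] := eqVneq (struct_cst (R := R) i j k) 0; first by rewrite mulr0.
by move: Ak; rewrite (AA' i j k (Ax _ xi) (Ay _ yj) cst0).
Qed.

Lemma g_solvable : lie_algebra G `<=` range L -> solvable_lieGroup G.
Proof.
(* The successive derived algebras lie in the span of [e_1, e_2, e_3], in the line of [e_3], and in
   0. *)
move=> LG; exists 3 => /= z.
have struct0 := (subrr, mulr0, addr0, oppr0, eqxx).
have D0 : lie_algebra G `<=` L @` support_in predT.
  by move=> X /LG[x _ <-]; exists x.
have D1 := @derived_support predT (fun i => i < 3)%N _ _ D0.
have D2 := @derived_support (fun i => i < 3)%N (pred1 2%N) _ _ (D1 _).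
have D3 := @derived_support (pred1 2%N) pred0 _ _ (D2 _ _).
case/D3 => [i j k|i j k|i j k|x x0 <-]; first 3 last.
- rewrite (_ : x = 0) ?linear0//; apply/rowP => i; rewrite mxE.
  by apply/eqP; apply: contraT => /x0.
- by ord5 i; ord5 j; ord5 k; rewrite /struct_cst /e2 /= ?struct0.
- by ord5 i; ord5 j; ord5 k; rewrite /struct_cst /e2 /= ?struct0.
- by ord5 i; ord5 j; ord5 k; rewrite /struct_cst /e2 /= ?struct0.
Qed.

End Solvable.

Unset Implicit Arguments.

Theorem proposition5p1 (R : realType) (G : lieGroup R 5)
    (G_connected : connected [set: G])
    (G_simply_connected : simply_connected R G)
    (G_lie_algebra : has_lie_algebra G (@g_bracket R)) :
  solvable_lieGroup G /\
  exists (alpha : covector_field G) (omega g : bilinear_field G)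
         (nabla : @connection R 5 G) (tau : R),
    [/\ @almost_cokahler R 2 G alpha omega g,
        is_levi_civita g nabla,
        einstein g nabla tau,
        ~ @cokahler R 2 G alpha omega g nabla &
        forall (U : set G) (f : 'I_5 -> vector_field G), open U ->
          orthonormal_frame g U f ->
          forall p, U p ->
            (tau - @tau_star R 2 G omega g nabla f p) / tau = 4^-1].
Proof.
have [L [L_inj L_lie L_br]] := G_lie_algebra; split.
  by apply: g_solvable L_br _; rewrite L_lie.
pose E := left_frame L.
have smE : forall i, smooth_field setT (E i) := smooth_left_frame L_lie.
have uE : forall p, frame_mx E p \in unitmx := left_frame_unit L_inj L_lie.
have brE i j p : lie_bracket (E i) (E j) p = struct_row i j *m frame_mx E p.
  by rewrite /E /left_frame -L_br g_bracket_delta mul_left_frame.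
(* [ord_max] is the index 4, so this covector is [e^5], the last one of the coframe. *)
pose a : 'cV[R]_5 := delta_mx ord_max 0.
have contact : @almost_contact_metric R 2 G
    (cform E a) (bform E omega_mx) (bform E 1%:M).
  split.
  - exact: smooth_cform.
  - exact: smooth_bform.
  - exact: bform1_riemannian.
  move=> p; exists setT, (fun i => cform E (delta_mx i 0)); split => //.
  - exact: openT.
  - split; first by move=> i; exact: smooth_cform.
    by move=> q i j _; exact: coframe_orthonormal.
  move=> q _; rewrite !big_ord_recl big_ord0 addr0 -!bform_wedge -bformD.
  by congr (bform E (_ + _) q).
exists (cform E a), (bform E omega_mx), (bform E 1%:M), (nabla E christoffel_mx),
  (- (3 / 2)); split.
- split => //.
    apply: (closed1_cform smE uE brE) => i j; apply/rowP => k.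
    (* The product is the last component of a bracket, given by the default branch 0 of
       [struct_cst]. *)
    by rewrite -colE !mxE.
  apply: (closed2_bform smE uE brE) => [|i j k]; first exact: omega_mx_skew.
  by rewrite !struct_row_omega w_closed.
- apply: (nabla_levi_civita smE uE brE).
    exact: christoffel_mx_skew.
  exact: christoffel_mx_torsion.
- apply: (nabla_einstein smE uE brE) => b c.
  by rewrite -ricci_cst -sum_ord5; apply: eq_bigr => e _; rewrite curv0_cst.
- case=> _ _ par _.
  (* Parallelism is contradicted at a single point, for which the unit of the group is taken. *)
  have := parallel1_frame smE uE (lg_one G) (ord0 : 'I_5) (inord 1) par.
  rewrite -colE !mxE inordK//= => /eqP.
  by rewrite mulf_eq0 invr_eq0 sqrtr_eq0 !pnatr_eq0/= orbF leNgt ltr0n.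
move=> U f oU f_orth p Up.
have := inner2_star smE uE brE oU f_orth Up omega_mx_skew star_mx_skew.
rewrite star_mx_trace /tau_star; set t := inner2 _ _ _ _ => t2.
(* Here [2 * t] is the trace [- (9 / 2)]; the factor 1/2 in [tau_star], from [n = 2], then gives
   [- (9 / 8)]. *)
have -> : t = - (9 / 4) by lra.
by field.
Qed.
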